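(* Let $\mathcal{H},\mathcal{K}$ be complex Hilbert spaces, let $0<m<M$ be real numbers, let $A\in\mathcal{B}(\mathcal{H})$ be a self-adjoint operator with $m\mathbf{1}_{\mathcal{H}}\le A\le M\mathbf{1}_{\mathcal{H}}$, and let $\Phi:\mathcal{B}(\mathcal{H})\to\mathcal{B}(\mathcal{K})$ be a positive unital linear map. Then $$\Phi(A^{-1})\le\Phi\left(\int_0^1\Big(\frac{M\mathbf{1}_{\mathcal{H}}-A}{M-m}m^{-t}+\frac{A-m\mathbf{1}_{\mathcal{H}}}{M-m}M^{-t}\Big)^{\frac1t}dt\right)\le\frac{(M+m)^2}{4Mm}\,\Phi(A)^{-1}.$$
   Context: $\mathcal{B}(\mathcal{H})$ is the algebra of bounded linear operators on $\mathcal{H}$ and $\mathbf{1}_{\mathcal{H}}$ is the identity operator. For self-adjoint operators, $X\le Y$ means $Y-X$ is positive, i.e. $\langle Xx,x\rangle\le\langle Yx,x\rangle$ for all $x$. A linear map $\Phi$ is positive if it sends positive operators to positive operators, and unital if $\Phi(\mathbf{1}_{\mathcal{H}})=\mathbf{1}_{\mathcal{K}}$. Powers of self-adjoint operators are defined by the continuous functional calculus. The integral over $t\in(0,1)$ is the integral of a norm-continuous bounded operator-valued function (the value at the endpoint $t=0$ is irrelevant). *)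

(* Defs.v *)
From Stdlib Require Import Reals Lra.
From Stdlib Require Import ClassicalEpsilon ProofIrrelevance.
From Stdlib Require Import FunctionalExtensionality PropExtensionality.
From Coquelicot Require Import Coquelicot.

Open Scope R_scope.

(* The inner product is linear in its first argument.  Positive definiteness
   follows from [inner_norm], since the norm of a normed module is definite. *)
Record Hilbert := MkHilbert {
  hilb :> CompleteNormedModule C_AbsRing;
  inner : hilb -> hilb -> C;
  inner_plus_l : forall x y z : hilb,
    inner (plus x y) z = Cplus (inner x z) (inner y z);
  inner_scal_l : forall (c : C) (x y : hilb),
    inner (scal c x) y = Cmult c (inner x y);
  inner_conj : forall x y : hilb, inner y x = Cconj (inner x y);
  inner_norm : forall x : hilb, inner x x = RtoC (norm x ^ 2)
}.

Arguments inner {h} _ _.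

(* [is_linear] is complex linearity together with boundedness. *)
Record Op (H : Hilbert) := MkOp {
  op_fun :> H -> H;
  op_linear : is_linear op_fun
}.

Arguments MkOp {H} _ _.
Arguments op_fun {H} _ _.
Arguments op_linear {H} _.

Lemma op_ext {H : Hilbert} (S T : Op H) : (forall x, S x = T x) -> S = T.
Proof.
destruct S as [s hs], T as [t ht]; simpl; intros E.
assert (e : s = t) by (apply functional_extensionality; exact E).
subst t; f_equal; apply proof_irrelevance.
Qed.

Lemma op_plus_linear {H : Hilbert} (S T : Op H) :
  is_linear (fun x : H => plus (S x) (T x)).
Proof.
exact (is_linear_comp (fun x : H => (S x, T x)) (fun p => plus (fst p) (snd p))
  (is_linear_prod _ _ (op_linear S) (op_linear T)) is_linear_plus).
Qed.

Lemma op_opp_linear {H : Hilbert} (T : Op H) :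
  is_linear (fun x : H => opp (T x)).
Proof. exact (is_linear_comp T opp (op_linear T) is_linear_opp). Qed.

Lemma op_scal_linear {H : Hilbert} (c : C) (T : Op H) :
  is_linear (fun x : H => scal (c : C_AbsRing) (T x)).
Proof.
exact (is_linear_comp T (scal (c : C_AbsRing)) (op_linear T)
  (is_linear_scal_r (c : C_AbsRing) Cmult_comm)).
Qed.

Lemma op_comp_linear {H : Hilbert} (S T : Op H) :
  is_linear (fun x : H => S (T x)).
Proof. exact (is_linear_comp T S (op_linear T) (op_linear S)). Qed.

Definition op_zero {H : Hilbert} : Op H := MkOp _ is_linear_zero.
Definition op_one {H : Hilbert} : Op H := MkOp _ is_linear_id.
Definition op_plus {H : Hilbert} (S T : Op H) : Op H := MkOp _ (op_plus_linear S T).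
Definition op_opp {H : Hilbert} (T : Op H) : Op H := MkOp _ (op_opp_linear T).
Definition op_scal {H : Hilbert} (c : C) (T : Op H) : Op H := MkOp _ (op_scal_linear c T).
Definition op_mult {H : Hilbert} (S T : Op H) : Op H := MkOp _ (op_comp_linear S T).

Lemma hilb_norm_zero (H : Hilbert) : norm (zero : H) = 0.
Proof. exact norm_zero. Qed.

Lemma hilb_norm_scal (H : Hilbert) (c : C) (x : H) :
  norm (scal (c : C_AbsRing) x) <= Cmod c * norm x.
Proof. exact (norm_scal (c : C_AbsRing) x). Qed.

Lemma hilb_norm_plus_le (H : Hilbert) (x y : H) (a b : R) :
  norm x <= a -> norm y <= b -> norm (plus x y) <= a + b.
Proof.
intros hx hy; apply Rle_trans with (1 := norm_triangle x y); lra.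
Qed.

Lemma hilb_norm_minus_le (H : Hilbert) (x y : H) (a b : R) :
  norm x <= a -> norm y <= b -> norm (plus x (opp y)) <= a + b.
Proof.
intros hx hy; apply hilb_norm_plus_le; [exact hx|].
apply Rle_trans with (2 := hy); apply Req_le; exact (norm_opp y).
Qed.

Definition op_norm {H : Hilbert} (T : Op H) : R :=
  real (Lub_Rbar (fun r => exists x : H, norm x <= 1 /\ r = norm (T x))).

Lemma op_norm_ub {H : Hilbert} (T : Op H) (x : H) :
  norm x <= 1 -> norm (T x) <= op_norm T.
Proof.
intros hx; unfold op_norm.
set (E := fun r => exists x : H, norm x <= 1 /\ r = norm (T x)).
destruct (Lub_Rbar_correct E) as [ub lub].
destruct (linear_norm _ (op_linear T)) as [m [m0 hm]].
assert (U : Rbar_le (Lub_Rbar E) m).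
{ apply lub; intros r [y [hy ->]]; simpl.
  apply Rle_trans with (1 := hm y); nra. }
assert (L : Rbar_le (norm (T x)) (Lub_Rbar E)) by (apply ub; exists x; auto).
destruct (Lub_Rbar E); simpl in *; easy.
Qed.

Lemma op_norm_lub {H : Hilbert} (T : Op H) (c : R) :
  (forall x, norm x <= 1 -> norm (T x) <= c) -> op_norm T <= c.
Proof.
intros hc; unfold op_norm.
set (E := fun r => exists x : H, norm x <= 1 /\ r = norm (T x)).
destruct (Lub_Rbar_correct E) as [ub lub].
assert (U : Rbar_le (Lub_Rbar E) c).
{ apply lub; intros r [y [hy ->]]; exact (hc y hy). }
assert (L : Rbar_le (norm (T zero)) (Lub_Rbar E)).
{ apply ub; exists zero; split; [rewrite hilb_norm_zero; lra | easy]. }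
destruct (Lub_Rbar E); simpl in *; easy.
Qed.

Lemma op_norm_ge_0 {H : Hilbert} (T : Op H) : 0 <= op_norm T.
Proof.
apply Rle_trans with (norm (T zero)); [apply norm_ge_0|].
apply op_norm_ub; rewrite hilb_norm_zero; lra.
Qed.

Lemma op_norm_le {H : Hilbert} (T : Op H) (x : H) :
  norm (T x) <= op_norm T * norm x.
Proof.
destruct (Req_dec (norm x) 0) as [e|e].
{ generalize (norm_eq_zero _ e) (linear_zero _ (op_linear T)); intros -> ->.
  rewrite hilb_norm_zero; lra. }
assert (p : 0 < norm x) by (generalize (norm_ge_0 x); lra).
set (y := scal (RtoC (/ norm x) : C_AbsRing) x).
assert (a : forall r, 0 < r -> Cmod (RtoC r) = r).
{ intros r hr; rewrite Cmod_R; apply Rabs_pos_eq; lra. }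
assert (ny : norm y <= 1).
{ apply Rle_trans with (1 := hilb_norm_scal H _ _); rewrite a.
  - rewrite Rinv_l; [lra | exact e].
  - apply Rinv_0_lt_compat; exact p. }
assert (xy : x = scal (RtoC (norm x) : C_AbsRing) y).
{ unfold y; rewrite scal_assoc.
  replace (mult _ _) with (one : C_AbsRing); [symmetry; apply (scal_one x)|].
  change (RtoC 1 = Cmult (RtoC (norm x)) (RtoC (/ norm x))).
  rewrite <- RtoC_mult, Rinv_r; [easy | exact e]. }
assert (Txy : T x = scal (RtoC (norm x) : C_AbsRing) (T y)).
{ rewrite xy at 1; apply (linear_scal _ (op_linear T)). }
rewrite Txy.
apply Rle_trans with (1 := hilb_norm_scal H _ _); rewrite a by exact p.
generalize (op_norm_ub T y ny); nra.
Qed.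

Definition op_AbelianMonoid_mixin (H : Hilbert) : AbelianMonoid.mixin_of (Op H).
Proof.
apply (AbelianMonoid.Mixin (Op H) op_plus op_zero);
  intros; apply op_ext; intro; simpl.
- apply plus_comm.
- apply plus_assoc.
- apply plus_zero_r.
Defined.

Canonical Op_AbelianMonoid (H : Hilbert) :=
  AbelianMonoid.Pack (Op H) (op_AbelianMonoid_mixin H) (Op H).

Definition op_AbelianGroup_mixin (H : Hilbert) :
  AbelianGroup.mixin_of (Op_AbelianMonoid H).
Proof.
apply (AbelianGroup.Mixin (Op_AbelianMonoid H) op_opp).
intros x; apply op_ext; intros y; exact (plus_opp_r (x y)).
Defined.

Canonical Op_AbelianGroup (H : Hilbert) :=
  AbelianGroup.Pack (Op H)
    (AbelianGroup.Class _ _ (op_AbelianGroup_mixin H)) (Op H).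

Definition op_Ring_mixin (H : Hilbert) : Ring.mixin_of (Op_AbelianGroup H).
Proof.
apply (Ring.Mixin (Op_AbelianGroup H) op_mult op_one);
  intros; apply op_ext; intro; try reflexivity.
apply (linear_plus _ (op_linear x)).
Defined.

Canonical Op_Ring (H : Hilbert) :=
  Ring.Pack (Op H) (Ring.Class _ _ (op_Ring_mixin H)) (Op H).

(* Only the real scalars are registered canonically, as the Riemann integral
   requires; complex scalars act through [op_scal]. *)
Definition op_ModuleSpace_mixin (H : Hilbert) :
  ModuleSpace.mixin_of R_Ring (Op_AbelianGroup H).
Proof.
apply (ModuleSpace.Mixin R_Ring (Op_AbelianGroup H)
         (fun r T => op_scal (RtoC r) T));
  intros; apply op_ext; intro z; simpl.
- rewrite scal_assoc; f_equal; symmetry; apply RtoC_mult.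
- exact (scal_one (u z)).
- exact (scal_distr_l (RtoC x : C_AbsRing) (u z) (v z)).
- rewrite RtoC_plus; exact (scal_distr_r (RtoC x : C_AbsRing) (RtoC y) (u z)).
Defined.

Canonical Op_ModuleSpace (H : Hilbert) :=
  ModuleSpace.Pack R_Ring (Op H)
    (ModuleSpace.Class _ _ _ (op_ModuleSpace_mixin H)) (Op H).

Lemma op_norm_plus {H : Hilbert} (S T : Op H) :
  op_norm (plus S T) <= op_norm S + op_norm T.
Proof.
apply op_norm_lub; intros x hx.
apply Rle_trans with (1 := norm_triangle (S x) (T x)).
apply Rplus_le_compat; apply op_norm_ub; exact hx.
Qed.

Lemma op_norm_scal {H : Hilbert} (r : R) (T : Op H) :
  op_norm (scal r T) <= Rabs r * op_norm T.
Proof.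
apply op_norm_lub; intros x hx.
apply Rle_trans with (1 := hilb_norm_scal H (RtoC r) (T x)); rewrite Cmod_R.
apply Rmult_le_compat_l; [apply Rabs_pos | apply op_norm_ub; exact hx].
Qed.

Lemma op_norm_zero {H : Hilbert} : op_norm (zero : Op H) = 0.
Proof.
apply Rle_antisym; [|apply op_norm_ge_0].
apply op_norm_lub; intros x _; apply Req_le; exact (hilb_norm_zero H).
Qed.

Lemma op_norm_opp {H : Hilbert} (T : Op H) : op_norm (opp T) = op_norm T.
Proof.
assert (h : forall S : Op H, op_norm (opp S) <= op_norm S).
{ intros S; apply op_norm_lub; intros x hx.
  apply Rle_trans with (norm (S x)); [|apply op_norm_ub; exact hx].
  apply Req_le; exact (norm_opp (S x)). }
apply Rle_antisym; [apply h|].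
rewrite <- (opp_opp T) at 1; apply h.
Qed.

Lemma op_norm_eq_0 {H : Hilbert} (T : Op H) : op_norm T = 0 -> T = zero.
Proof.
intros e; apply op_ext; intros x; apply norm_eq_zero.
generalize (op_norm_le T x) (norm_ge_0 (T x)); rewrite e; intros; lra.
Qed.

Definition op_ball {H : Hilbert} (S : Op H) (e : R) (T : Op H) : Prop :=
  op_norm (minus T S) < e.

Definition op_UniformSpace_mixin (H : Hilbert) : UniformSpace.mixin_of (Op H).
Proof.
apply (UniformSpace.Mixin (Op H) zero op_ball); unfold op_ball.
- intros x e; rewrite minus_eq_zero.
  apply Rle_lt_trans with 0; [apply Req_le; exact op_norm_zero | apply cond_pos].
- intros x y e h; rewrite <- opp_minus, op_norm_opp; exact h.
- intros x y z e1 e2 h1 h2.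
  rewrite (minus_trans y), plus_comm.
  apply Rle_lt_trans with (1 := op_norm_plus _ _); lra.
Defined.

Canonical Op_UniformSpace (H : Hilbert) :=
  UniformSpace.Pack (Op H) (op_UniformSpace_mixin H) (Op H).

Canonical Op_NormedModuleAux (H : Hilbert) :=
  NormedModuleAux.Pack R_AbsRing (Op H)
    (NormedModuleAux.Class R_AbsRing (Op H)
       (ModuleSpace.class _ (Op_ModuleSpace H)) (op_UniformSpace_mixin H)) (Op H).

Definition op_NormedModule_mixin (H : Hilbert) :
  NormedModule.mixin_of R_AbsRing (Op_NormedModuleAux H).
Proof.
apply (NormedModule.Mixin R_AbsRing (Op_NormedModuleAux H) op_norm 1).
- exact op_norm_plus.
- exact op_norm_scal.
- intros x y e h; exact h.
- intros x y e h; rewrite Rmult_1_l; exact h.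
- exact op_norm_eq_0.
Defined.

Canonical Op_NormedModule (H : Hilbert) :=
  NormedModule.Pack R_AbsRing (Op H)
    (NormedModule.Class _ _ _ (op_NormedModule_mixin H)) (Op H).

(* A Cauchy filter of operators converges pointwise on H; the pointwise limit
   is bounded and is the limit in operator norm. *)
Lemma op_complete {H : Hilbert} (F : (Op H -> Prop) -> Prop) :
  ProperFilter F -> cauchy F ->
  exists L : Op H, forall e : posreal, F (ball L e).
Proof.
intros PF CF.
assert (near : forall e : posreal, exists T0 : Op H,
          F (fun T => forall x, norm (minus (T x) (T0 x)) <= e * norm x)).
{ intros e; destruct (CF e) as [T0 h0]; exists T0.
  apply filter_imp with (2 := h0); intros T hT x.
  apply Rle_trans with (1 := op_norm_le (minus T T0) x).
  apply Rmult_le_compat_r; [apply norm_ge_0 | apply Rlt_le; exact hT]. }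
assert (lims : forall x : H, exists l : H,
          filterlim (fun T : Op H => T x) F (locally l)).
{ intros x.
  exists (lim (filtermap (fun T : Op H => T x) F)).
  apply filterlim_locally; intros e.
  apply (complete_cauchy (filtermap (fun T : Op H => T x) F)).
  - apply filtermap_proper_filter; exact PF.
  - intros d.
    assert (p : 0 < d / (norm x + 1)).
    { apply Rdiv_lt_0_compat; [apply cond_pos | generalize (norm_ge_0 x); lra]. }
    destruct (near (mkposreal _ p)) as [T0 h0]; exists (T0 x).
    unfold filtermap; apply filter_imp with (2 := h0); intros T hT.
    apply (norm_compat1 (T0 x) (T x)).
    apply Rle_lt_trans with (1 := hT x); simpl.
    apply Rlt_le_trans with (d / (norm x + 1) * (norm x + 1)); [nra|].
    apply Req_le; field; generalize (norm_ge_0 x); lra. }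
set (l := fun x => proj1_sig (constructive_indefinite_description _ (lims x))).
assert (hl : forall x, filterlim (fun T : Op H => T x) F (locally (l x))).
{ intros x; exact (proj2_sig (constructive_indefinite_description _ (lims x))). }
assert (close_l : forall e : posreal, exists T0 : Op H,
          F (fun T => forall x, norm (minus (T x) (T0 x)) <= e * norm x) /\
          (forall x, norm (minus (l x) (T0 x)) <= e * norm x)).
{ intros e; destruct (near e) as [T0 h0]; exists T0; split; [exact h0|].
  intros x; apply le_epsilon; intros d hd.
  generalize (proj1 (filterlim_locally_ball_norm _ _) (hl x) (mkposreal d hd)).
  intros h1.
  destruct (filter_ex _ (filter_and _ _ h0 h1)) as [T [a b]].
  unfold ball_norm in b; simpl in b.
  assert (t : minus (l x) (T0 x) = plus (minus (T x) (T0 x)) (opp (minus (T x) (l x)))).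
  { rewrite opp_minus, (minus_trans (T x) (l x)); apply plus_comm. }
  rewrite t; apply hilb_norm_minus_le; [exact (a x) | exact (Rlt_le _ _ b)]. }
assert (lin : is_linear l).
{ split.
  - intros x y.
    apply (filterlim_locally_unique (F := F) (fun T : Op H => T (plus x y))).
    + apply hl.
    + apply filterlim_ext with (fun T : Op H => plus (T x) (T y)).
      { intros T; symmetry; apply (linear_plus _ (op_linear T)). }
      eapply filterlim_comp_2;
        [exact (hl x) | exact (hl y) | exact (filterlim_plus (l x) (l y))].
  - intros k x.
    apply (filterlim_locally_unique (F := F) (fun T : Op H => T (scal k x))).
    + apply hl.
    + apply filterlim_ext with (fun T : Op H => scal k (T x)).
      { intros T; symmetry; apply (linear_scal _ (op_linear T)). }
      eapply filterlim_comp; [exact (hl x) | exact (filterlim_scal_r k (l x))].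
  - destruct (close_l (mkposreal 1 Rlt_0_1)) as [T0 [_ h0]].
    exists (op_norm T0 + 1); split; [generalize (op_norm_ge_0 T0); lra|].
    intros x.
    assert (t : l x = plus (minus (l x) (T0 x)) (T0 x)).
    { unfold minus; rewrite <- plus_assoc, plus_opp_l; symmetry; apply plus_zero_r. }
    rewrite t; replace ((op_norm T0 + 1) * norm x)
      with (1 * norm x + op_norm T0 * norm x) by ring.
    apply hilb_norm_plus_le; [exact (h0 x) | apply op_norm_le]. }
exists (MkOp l lin); intros e.
assert (p : 0 < e / 4) by (generalize (cond_pos e); lra).
destruct (close_l (mkposreal _ p)) as [T0 [h0 h1]]; simpl in h0, h1.
apply filter_imp with (2 := h0); intros T hT.
change (op_norm (minus T (MkOp l lin)) < e).
apply Rle_lt_trans with (e / 2); [|generalize (cond_pos e); lra].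
apply op_norm_lub; intros x hx.
change (norm (minus (T x) (l x)) <= e / 2).
assert (t : minus (T x) (l x) = plus (minus (T x) (T0 x)) (opp (minus (l x) (T0 x)))).
{ rewrite opp_minus; apply minus_trans. }
rewrite t; replace (e / 2) with (e / 4 + e / 4) by field.
apply hilb_norm_minus_le.
- apply Rle_trans with (1 := hT x); nra.
- apply Rle_trans with (1 := h1 x); nra.
Qed.

Definition op_lim {H : Hilbert} (F : (Op H -> Prop) -> Prop) : Op H :=
  epsilon (inhabits op_zero) (fun L : Op H => forall e : posreal, F (ball L e)).

Definition op_CompleteSpace_mixin (H : Hilbert) :
  CompleteSpace.mixin_of (Op_UniformSpace H).
Proof.
apply (CompleteSpace.Mixin (Op_UniformSpace H) op_lim).
- intros F PF CF; unfold op_lim; apply epsilon_spec.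
  exact (op_complete F PF CF).
- intros F1 F2 h1 h2.
  replace F2 with F1; [apply close_refl|].
  apply functional_extensionality; intros P.
  apply propositional_extensionality; split; [apply h2 | apply h1].
Defined.

Canonical Op_CompleteSpace (H : Hilbert) :=
  CompleteSpace.Pack (Op H)
    (CompleteSpace.Class _ _ (op_CompleteSpace_mixin H)) (Op H).

Canonical Op_CompleteNormedModule (H : Hilbert) :=
  CompleteNormedModule.Pack R_AbsRing (Op H)
    (CompleteNormedModule.Class R_AbsRing (Op H)
       (NormedModule.class _ (Op_NormedModule H)) (op_CompleteSpace_mixin H)) (Op H).

Definition self_adjoint {H : Hilbert} (T : Op H) : Prop :=
  forall x y : H, inner (T x) y = inner x (T y).

Definition positive {H : Hilbert} (T : Op H) : Prop :=
  self_adjoint T /\ forall x : H, 0 <= Re (inner (T x) x).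

Definition op_le {H : Hilbert} (S T : Op H) : Prop := positive (minus T S).

Definition is_op_inv {H : Hilbert} (T S : Op H) : Prop :=
  mult S T = op_one /\ mult T S = op_one.

(* [iota P] is the element satisfying [P] when it is unique; [op_inv T] is
   thus meaningful only for invertible [T]. *)
Definition op_inv {H : Hilbert} (T : Op H) : Op H := iota (is_op_inv T).

Definition spectrum {H : Hilbert} (T : Op H) (z : C) : Prop :=
  ~ exists S : Op H, is_op_inv (minus T (op_scal z op_one)) S.

Definition poly_eval (a : nat -> R) (n : nat) (x : R) : R :=
  sum_n (fun k => a k * x ^ k) n.

Definition poly_op {H : Hilbert} (a : nat -> R) (n : nat) (T : Op H) : Op H :=
  sum_n (fun k => scal (a k) (pow_n T k)) n.

(* Continuous functional calculus of a self-adjoint T, whose spectrum is real: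
   Y = f(T) when p_n(T) -> Y in operator norm for real polynomials p_n
   converging to f uniformly on the spectrum of T. *)
Definition is_cfc {H : Hilbert} (f : R -> R) (T Y : Op H) : Prop :=
  exists (a : nat -> nat -> R) (d : nat -> nat),
    (forall e : posreal, eventually (fun n => forall x : R,
       spectrum T (RtoC x) -> Rabs (poly_eval (a n) (d n) x - f x) < e)) /\
    filterlim (fun n => poly_op (a n) (d n) T) eventually (locally Y).

Definition cfc {H : Hilbert} (f : R -> R) (T : Op H) : Op H := iota (is_cfc f T).

(* [Rpower x r] is the real power x^r only for x > 0, so [op_power T r] is
   meant for self-adjoint T with spectrum in (0, +oo). *)
Definition op_power {H : Hilbert} (T : Op H) (r : R) : Op H :=
  cfc (fun x => Rpower x r) T.

Definition linear_map {H K : Hilbert} (Phi : Op H -> Op K) : Prop :=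
  (forall S T : Op H, Phi (plus S T) = plus (Phi S) (Phi T)) /\
  (forall (c : C) (T : Op H), Phi (op_scal c T) = op_scal c (Phi T)).

Definition positive_map {H K : Hilbert} (Phi : Op H -> Op K) : Prop :=
  forall T : Op H, positive T -> positive (Phi T).

Definition unital_map {H K : Hilbert} (Phi : Op H -> Op K) : Prop :=
  Phi op_one = op_one.

(* Main.v *)
From Stdlib Require Import Lra Lia Classical ClassicalEpsilon FunctionalExtensionality.
Require Import Defs.
From Stdlib Require Import Reals.
From Coquelicot Require Import Coquelicot.
Open Scope R_scope.
Set Bullet Behavior "Strict Subproofs".

(** Put w = (M - s) / (M - m), so that s = w m + (1 - w) M, and
    G(t, s) = (w m^(-t) + (1 - w) M^(-t))^(1/t).  For s in [m, M] and 0 < t <= 1 one has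
      1 / s <= G(t, s) <= w / m + (1 - w) / M = (M + m - s) / (M m):
    the left inequality is the convexity of x^(-t), the right one says that the
    power mean of 1/m and 1/M with exponent t is at most their arithmetic mean
    ([gmean_ge], [gmean_le]).  The integrand is G(t, A), so that integration gives
      A^(-1) <= J <= (M + m - A) / (M m)
    ([mean_integral_bounds]).  A positive unital map Phi keeps these inequalities,
    B = Phi(A) again lies between m and M, and
    (M + m - s) / (M m) <= (M + m)^2 / (4 M m s) on [m, M] because
    4 s (M + m - s) <= (M + m)^2 ([chord_le_inv]).

    This rests on a functional calculus for a self-adjoint T lying between lo and
    hi.  Its core is that the norm of p(T) is |p(l)| for some l in the spectrum of
    T, when p is a real polynomial and p(T) is nonzero ([poly_norm_attained]).  With N the norm of
    p(T), the operator D = N^2 - p(T)^2 has approximate null vectors.  They are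
    nearly preserved by T, and minimising <T x, x> over them yields vectors that
    are moreover approximate eigenvectors of T ([joint_approx_eigenvector]);
    evaluating D on them gives N^2 = p(l)^2.  Polynomial approximation then defines
    f(T) for every f continuous on [lo, hi], compatibly with order and composition,
    and identifies it with the calculus over the spectrum ([cfc_eq]).

    The Riemann integral exists because t |-> G(t, A) extends to a norm-continuous
    function at t = 0: ln G(t, s) is the difference quotient at 0 of
    ln (w m^(-t) + (1 - w) M^(-t)), whose second derivative, a variance, is bounded
    uniformly in s ([log_mean_lipschitz], [mean_integral]). *)

(** * The real inner product *)

(** The real part of the inner product suffices for every estimate: it is
    symmetric and real bilinear, and it determines the norm, self-adjointness and
    the order. *)
Definition ip {H : Hilbert} (x y : H) : R := Re (inner x y).
Definition rscal {H : Hilbert} (r : R) (x : H) : H := scal (RtoC r : C_AbsRing) x.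

Lemma hilb_norm_eq_zero {H : Hilbert} (x : H) : norm x = 0 -> x = zero.
Proof. exact (norm_eq_zero x). Qed.

Lemma hilb_norm_opp {H : Hilbert} (x : H) : norm (opp x) = norm x.
Proof. exact (norm_opp x). Qed.

Lemma ip_plus_l {H : Hilbert} (x y z : H) : ip (plus x y) z = ip x z + ip y z.
Proof. unfold ip; now rewrite inner_plus_l. Qed.

Lemma ip_rscal_l {H : Hilbert} (r : R) (x z : H) : ip (rscal r x) z = r * ip x z.
Proof. unfold ip, rscal; rewrite inner_scal_l; unfold Re; simpl; ring. Qed.

Lemma ip_sym {H : Hilbert} (x y : H) : ip x y = ip y x.
Proof. unfold ip; now rewrite (inner_conj _ x y). Qed.

Lemma ip_self {H : Hilbert} (x : H) : ip x x = norm x ^ 2.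
Proof. unfold ip; now rewrite inner_norm. Qed.

Lemma ip_zero_l {H : Hilbert} (z : H) : ip zero z = 0.
Proof.
generalize (ip_plus_l zero zero z); rewrite plus_zero_l; lra.
Qed.

Lemma ip_opp_l {H : Hilbert} (x z : H) : ip (opp x) z = - ip x z.
Proof.
generalize (ip_plus_l x (opp x) z).
replace (plus x (opp x)) with (zero : H) by (symmetry; exact (plus_opp_r x)).
rewrite ip_zero_l; lra.
Qed.

Lemma ip_minus_l {H : Hilbert} (x y z : H) : ip (minus x y) z = ip x z - ip y z.
Proof. change (ip (plus x (opp y)) z = ip x z - ip y z); rewrite ip_plus_l, ip_opp_l; ring. Qed.

Lemma ip_plus_r {H : Hilbert} (x y z : H) : ip z (plus x y) = ip z x + ip z y.
Proof. rewrite !(ip_sym z); apply ip_plus_l. Qed.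

Lemma ip_rscal_r {H : Hilbert} (r : R) (x z : H) : ip z (rscal r x) = r * ip z x.
Proof. rewrite !(ip_sym z); apply ip_rscal_l. Qed.

Lemma ip_opp_r {H : Hilbert} (x z : H) : ip z (opp x) = - ip z x.
Proof. rewrite !(ip_sym z); apply ip_opp_l. Qed.

Lemma ip_minus_r {H : Hilbert} (x y z : H) : ip z (minus x y) = ip z x - ip z y.
Proof. rewrite !(ip_sym z); apply ip_minus_l. Qed.

Lemma ip_zero_r {H : Hilbert} (z : H) : ip z zero = 0.
Proof. rewrite ip_sym; apply ip_zero_l. Qed.

(** Vector and operator identities are proved by pairing both sides with an
    arbitrary vector, which turns them into ring identities between reals. *)
Lemma ip_ext {H : Hilbert} (x y : H) : (forall z, ip x z = ip y z) -> x = y.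
Proof.
intros e.
assert (h : norm (minus x y) ^ 2 = 0).
{ rewrite <- ip_self, ip_minus_l, e; ring. }
assert (d : minus x y = (zero : H)).
{ apply (norm_eq_zero (minus x y)); generalize (norm_ge_0 (minus x y)); nra. }
apply (plus_reg_r (opp y)); transitivity (zero : H); [exact d|].
symmetry; exact (plus_opp_r y).
Qed.

Lemma op_plusE {H : Hilbert} (S T : Op H) (x : H) : plus S T x = plus (S x) (T x).
Proof. easy. Qed.

Lemma op_oppE {H : Hilbert} (S : Op H) (x : H) : opp S x = opp (S x).
Proof. easy. Qed.

Lemma op_minusE {H : Hilbert} (S T : Op H) (x : H) : minus S T x = minus (S x) (T x).
Proof. easy. Qed.

Lemma op_scalE {H : Hilbert} (r : R) (T : Op H) (x : H) : scal r T x = rscal r (T x).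
Proof. easy. Qed.

Lemma op_cscalE {H : Hilbert} (r : R) (T : Op H) (x : H) : op_scal (RtoC r) T x = rscal r (T x).
Proof. easy. Qed.

Lemma op_multE {H : Hilbert} (S T : Op H) (x : H) : mult S T x = S (T x).
Proof. easy. Qed.

Lemma op_oneE {H : Hilbert} (x : H) : op_one x = x.
Proof. easy. Qed.

Lemma ring_oneE {H : Hilbert} (x : H) : (one : Op H) x = x.
Proof. easy. Qed.

Lemma op_zeroE {H : Hilbert} (x : H) : (zero : Op H) x = zero.
Proof. easy. Qed.

Lemma op_app_plus {H : Hilbert} (T : Op H) (x y : H) : T (plus x y) = plus (T x) (T y).
Proof. apply (linear_plus _ (op_linear T)). Qed.

Lemma op_app_rscal {H : Hilbert} (T : Op H) (r : R) (x : H) : T (rscal r x) = rscal r (T x).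
Proof. apply (linear_scal _ (op_linear T)). Qed.

Lemma op_app_opp {H : Hilbert} (T : Op H) (x : H) : T (opp x) = opp (T x).
Proof. exact (linear_opp (T : H -> H) x (op_linear T)). Qed.

Lemma op_app_minus {H : Hilbert} (T : Op H) (x y : H) : T (minus x y) = minus (T x) (T y).
Proof.
change (T (plus x (opp y)) = plus (T x) (opp (T y))); now rewrite op_app_plus, op_app_opp.
Qed.

Lemma op_app_zero {H : Hilbert} (T : Op H) : T zero = zero.
Proof. exact (linear_zero (T : H -> H) (op_linear T)). Qed.

(** The structure argument of each operation is matched by a variable and left
    to conversion, since the same operation occurs through several convertible
    algebraic structures. *)
Ltac op_step :=
  match goal with
  | |- context [op_fun (@plus ?G ?S ?T) ?x] =>
      rewrite (op_plusE S T x : op_fun (@plus G S T) x = _)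
  | |- context [op_fun (@opp ?G ?S) ?x] =>
      rewrite (op_oppE S x : op_fun (@opp G S) x = _)
  | |- context [op_fun (@minus ?G ?S ?T) ?x] =>
      rewrite (op_minusE S T x : op_fun (@minus G S T) x = _)
  | |- context [op_fun (@scal ?K ?G ?r ?T) ?x] =>
      rewrite (op_scalE r T x : op_fun (@scal K G r T) x = _)
  | |- context [op_fun (op_scal (RtoC ?r) ?T) ?x] => rewrite (op_cscalE r T x)
  | |- context [op_fun (@mult ?G ?S ?T) ?x] =>
      rewrite (op_multE S T x : op_fun (@mult G S T) x = _)
  | |- context [op_fun op_one ?x] => rewrite (op_oneE x)
  | |- context [op_fun (@one ?G) ?x] => rewrite (ring_oneE x : op_fun (@one G) x = _)
  | |- context [op_fun (@zero ?G) ?x] => rewrite (op_zeroE x : op_fun (@zero G) x = _)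
  | |- context [op_fun ?T (@plus ?G ?x ?y)] =>
      rewrite (op_app_plus T x y : op_fun T (@plus G x y) = _)
  | |- context [op_fun ?T (@opp ?G ?x)] =>
      rewrite (op_app_opp T x : op_fun T (@opp G x) = _)
  | |- context [op_fun ?T (@minus ?G ?x ?y)] =>
      rewrite (op_app_minus T x y : op_fun T (@minus G x y) = _)
  | |- context [op_fun ?T (rscal ?r ?x)] => rewrite (op_app_rscal T r x)
  | |- context [op_fun ?T (@zero ?G)] =>
      rewrite (op_app_zero T : op_fun T (@zero G) = _)
  end.

Ltac ip_step :=
  match goal with
  | |- context [ip (@plus ?G ?x ?y) ?z] =>
      rewrite (ip_plus_l x y z : ip (@plus G x y) z = _)
  | |- context [ip (@opp ?G ?x) ?z] => rewrite (ip_opp_l x z : ip (@opp G x) z = _)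
  | |- context [ip (@minus ?G ?x ?y) ?z] =>
      rewrite (ip_minus_l x y z : ip (@minus G x y) z = _)
  | |- context [ip (rscal ?r ?x) ?z] => rewrite (ip_rscal_l r x z)
  | |- context [ip (@zero ?G) ?z] => rewrite (ip_zero_l z : ip (@zero G) z = _)
  | |- context [ip ?z (@plus ?G ?x ?y)] =>
      rewrite (ip_plus_r x y z : ip z (@plus G x y) = _)
  | |- context [ip ?z (@opp ?G ?x)] => rewrite (ip_opp_r x z : ip z (@opp G x) = _)
  | |- context [ip ?z (@minus ?G ?x ?y)] =>
      rewrite (ip_minus_r x y z : ip z (@minus G x y) = _)
  | |- context [ip ?z (rscal ?r ?x)] => rewrite (ip_rscal_r r x z)
  | |- context [ip ?z (@zero ?G)] => rewrite (ip_zero_r z : ip z (@zero G) = _)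
  end.

Ltac expand := repeat op_step; repeat ip_step.
Ltac vec := apply ip_ext; let z := fresh in intro z; expand; try ring.
Ltac op_vec := apply op_ext; let x := fresh in intro x; vec.

Lemma norm_rscal {H : Hilbert} (r : R) (x : H) : norm (rscal r x) = Rabs r * norm x.
Proof.
assert (h : norm (rscal r x) ^ 2 = (Rabs r * norm x) ^ 2).
{ rewrite <- ip_self, ip_rscal_l, ip_rscal_r, ip_self, Rpow_mult_distr, pow2_abs; ring. }
generalize (norm_ge_0 (rscal r x)) (norm_ge_0 x) (Rabs_pos r); intros.
apply Rsqr_inj; [easy|nra|unfold Rsqr; lra].
Qed.

Lemma ip_cauchy_schwarz {H : Hilbert} (x y : H) : Rabs (ip x y) <= norm x * norm y.
Proof.
assert (h : forall u v : H, ip u v <= norm u * norm v).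
{ intros u v.
  generalize (norm_ge_0 u) (norm_ge_0 v); intros hu hv.
  assert (q : forall s t : R, 0 <= s ^ 2 * norm u ^ 2 - 2 * s * t * ip u v + t ^ 2 * norm v ^ 2).
  { intros s t; generalize (pow2_ge_0 (norm (minus (rscal s u) (rscal t v)))).
    rewrite <- ip_self; expand.
    rewrite (ip_sym v u), !ip_self; lra. }
  destruct (Req_dec (norm u) 0) as [e|e].
  { generalize (hilb_norm_eq_zero _ e); intros ->; rewrite ip_zero_l; nra. }
  destruct (Req_dec (norm v) 0) as [e'|e'].
  { generalize (hilb_norm_eq_zero _ e'); intros ->; rewrite ip_zero_r; nra. }
  generalize (q (norm v) (norm u)); intros Q.
  assert (0 < norm u * norm v) by (apply Rmult_lt_0_compat; lra).
  apply Rmult_le_reg_l with (norm u * norm v); [easy | nra]. }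
apply Rabs_le; split; [|apply h].
generalize (h (opp x) y); rewrite ip_opp_l, hilb_norm_opp; lra.
Qed.

(** The imaginary part of <T x, y> is recovered from the real part by replacing
    x with i x. *)
Lemma self_adjoint_ip {H : Hilbert} (T : Op H) :
  self_adjoint T <-> forall x y, ip (T x) y = ip x (T y).
Proof.
split; intros h x y.
- unfold ip; now rewrite h.
- apply injective_projections; [exact (h x y)|].
  generalize (h (scal (Ci : C_AbsRing) x) y).
  replace (T (scal (Ci : C_AbsRing) x)) with (scal (Ci : C_AbsRing) (T x))
    by (symmetry; apply (linear_scal _ (op_linear T))).
  unfold ip; rewrite !inner_scal_l; unfold Re; simpl; lra.
Qed.

Lemma positive_ip {H : Hilbert} (T : Op H) :
  (forall x y, ip (T x) y = ip x (T y)) -> (forall x, 0 <= ip (T x) x) -> Defs.positive T.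
Proof. intros h p; split; [now apply self_adjoint_ip | exact p]. Qed.

Lemma op_le_ip {H : Hilbert} (S T : Op H) : op_le S T -> forall x, ip (S x) x <= ip (T x) x.
Proof.
intros [_ h] x; specialize (h x); change (0 <= ip (minus (T x) (S x)) x) in h.
rewrite ip_minus_l in h; lra.
Qed.

Lemma op_norm_mult {H : Hilbert} (S T : Op H) : op_norm (mult S T) <= op_norm S * op_norm T.
Proof.
apply op_norm_lub; intros x hx; rewrite op_multE.
apply Rle_trans with (1 := op_norm_le S (T x)).
apply Rmult_le_compat_l; [apply op_norm_ge_0 | apply op_norm_ub; exact hx].
Qed.

(** * Joint approximate eigenvectors *)

Lemma hilb_norm_minus {H : Hilbert} (x y : H) : norm (minus x y) <= norm x + norm y.
Proof. apply (hilb_norm_minus_le H x y); lra. Qed.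

Lemma op_form_bound {H : Hilbert} (T : Op H) (x : H) :
  Rabs (ip (T x) x) <= op_norm T * norm x ^ 2.
Proof.
apply Rle_trans with (1 := ip_cauchy_schwarz (T x) x).
generalize (op_norm_le T x) (norm_ge_0 x); nra.
Qed.

Lemma self_adjoint_shift {H : Hilbert} (T : Op H) (l : R) :
  self_adjoint T -> self_adjoint (minus T (scal l op_one)).
Proof.
intros h; apply self_adjoint_ip; intros x y; expand.
rewrite (proj1 (self_adjoint_ip T) h x y); ring.
Qed.

Definition approx_null {H : Hilbert} (D : Op H) (e : R) (x : H) : Prop :=
  norm x = 1 /\ norm (D x) <= e.

(** The vectors almost killed by D are nearly invariant under T, which commutes
    with D.  Let l be the limit, as the tolerance e tends to 0, of the infimum of
    <T x, x> over the unit vectors x with |D x| <= e.  Near this set S = T - l is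
    almost positive, and <S x, x> is almost 0 at a near-minimiser x; as for a
    positive form, this forces S x to be small. *)
Lemma joint_approx_eigenvector {H : Hilbert} (T D : Op H) :
  self_adjoint T -> (forall x, T (D x) = D (T x)) ->
  (forall e, 0 < e -> exists x, approx_null D e x) ->
  exists l : R, forall e, 0 < e ->
    exists x, approx_null D e x /\ norm (minus T (scal l op_one) x) <= e.
Proof.
intros sa comm ker.
set (E := fun r => exists e, 0 < e /\
            forall x, approx_null D e x -> r <= ip (T x) x).
assert (rng : forall x, norm x = 1 -> Rabs (ip (T x) x) <= op_norm T).
{ intros x hx; generalize (op_form_bound T x); rewrite hx; lra. }
destruct (completeness E) as [l [ub lub]].
{ exists (op_norm T); intros r [e [he h]].
  destruct (ker e he) as [x hx].
  apply Rle_trans with (1 := h x hx).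
  apply Rle_trans with (1 := Rle_abs _); apply rng, hx. }
{ exists (- op_norm T), 1; split; [lra|]; intros x [hx _].
  generalize (rng x hx); intros h; apply Rabs_le_between in h; lra. }
(* The two halves of the definition of l as a supremum of infima. *)
assert (low : forall d, 0 < d -> exists e, 0 < e /\
          forall x, approx_null D e x -> l - d <= ip (T x) x).
{ intros d hd; apply NNPP; intros no.
  assert (h : l <= l - d); [apply lub|lra].
  intros r [e [he h]]; apply Rnot_lt_le; intros lt; apply no.
  exists e; split; [easy|]; intros x hx; specialize (h x hx); lra. }
assert (high : forall d e, 0 < d -> 0 < e ->
          exists x, approx_null D e x /\ ip (T x) x < l + d).
{ intros d e hd he; apply NNPP; intros no.
  assert (h : l + d <= l); [apply ub; exists e; split; [easy|]|lra].
  intros x hx; apply Rnot_lt_le; intros lt; apply no; now exists x. }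
exists l; intros e he.
set (S := minus T (scal l op_one)).
assert (saS : forall x y, ip (S x) y = ip x (S y)).
{ now apply self_adjoint_ip, self_adjoint_shift. }
assert (formS : forall x, ip (S x) x = ip (T x) x - l * norm x ^ 2).
{ intros x; unfold S; expand; rewrite ip_self; ring. }
assert (commS : forall x, D (S x) = S (D x)).
{ intros x; unfold S; vec; now rewrite comm. }
set (c := op_norm S + 1).
assert (hc : 1 <= c) by (unfold c; generalize (op_norm_ge_0 S); lra).
assert (Sc : forall x, norm (S x) <= c * norm x).
{ intros x; generalize (op_norm_le S x) (norm_ge_0 x); unfold c; nra. }
set (d := e ^ 2 / (5 * c)).
assert (hd : 0 < d) by (apply Rdiv_lt_0_compat; [apply pow_lt; easy | lra]).
assert (dc : 5 * d * c = e ^ 2) by (unfold d; field; lra).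
set (eta := Rmin 1 (d / c)).
assert (heta : 0 < eta).
{ apply Rmin_glb_lt; [lra | apply Rdiv_lt_0_compat; lra]. }
assert (ceta : c * eta ^ 2 <= d).
{ assert (a : eta <= 1) by apply Rmin_l.
  assert (b : eta <= d / c) by apply Rmin_r.
  assert (c * eta <= d).
  { replace d with (c * (d / c)) by (field; lra); apply Rmult_le_compat_l; lra. }
  nra. }
destruct (low d hd) as [e0 [he0 lowd]].
(* Homogeneous form of the lower bound, for vectors of any length. *)
assert (lowS : forall y, norm (D y) <= e0 * norm y -> - d * norm y ^ 2 <= ip (S y) y).
{ intros y hy.
  destruct (Req_dec (norm y) 0) as [z|z].
  { generalize (hilb_norm_eq_zero y z); intros ->; expand; rewrite hilb_norm_zero; lra. }
  generalize (norm_ge_0 y); intros p.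
  set (r := / norm y).
  assert (hr : 0 < r) by (apply Rinv_0_lt_compat; lra).
  assert (ry : r * norm y = 1) by (unfold r; now apply Rinv_l).
  assert (nr : forall v : H, norm (rscal r v) = r * norm v).
  { intros v; rewrite norm_rscal, Rabs_pos_eq; lra. }
  assert (h : l - d <= ip (T (rscal r y)) (rscal r y)).
  { apply lowd; split; [now rewrite nr|].
    rewrite op_app_rscal, nr; nra. }
  revert h; expand; rewrite formS; intros h.
  replace (ip (T y) y) with (norm y ^ 2 * (r * (r * ip (T y) y))).
  - assert (0 <= norm y ^ 2) by nra.
    nra.
  - transitivity ((r * norm y) ^ 2 * ip (T y) y); [ring | rewrite ry; ring]. }
set (e1 := Rmin e (e0 * eta / 2)).
assert (he1 : 0 < e1).
{ apply Rmin_glb_lt; [easy|]; generalize (Rmult_lt_0_compat e0 eta he0 heta); lra. }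
assert (e1e : e1 <= e) by apply Rmin_l.
assert (e1eta : 2 * e1 <= e0 * eta).
{ assert (h : e1 <= e0 * eta / 2) by apply Rmin_r; lra. }
destruct (high d e1 hd he1) as [x [[hx Dx] Tx]].
exists x; split; [split; [easy | lra]|].
(* y is one gradient step from x for the form of S.  Its value <S y, y> is at
   most <S x, x> - |S x|^2 / c, but cannot fall much below 0. *)
set (y := minus x (rscal (/ c) (S x))).
assert (ic : 0 < / c) by (apply Rinv_0_lt_compat; lra).
assert (icc : / c * c = 1) by (apply Rinv_l; lra).
assert (nic : forall v : H, norm (rscal (/ c) v) = / c * norm v).
{ intros v; rewrite norm_rscal, Rabs_pos_eq; lra. }
assert (contr : forall v, norm (rscal (/ c) (S v)) <= norm v).
{ intros v; rewrite nic; generalize (Sc v); intros h.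
  apply Rle_trans with (/ c * (c * norm v)); [apply Rmult_le_compat_l; lra|].
  rewrite <- Rmult_assoc, icc; lra. }
assert (ny : norm y <= 2).
{ apply Rle_trans with (1 := hilb_norm_minus _ _); generalize (contr x); lra. }
assert (Dy : norm (D y) <= 2 * e1).
{ unfold y; rewrite op_app_minus, op_app_rscal, commS.
  apply Rle_trans with (1 := hilb_norm_minus _ _); generalize (contr (D x)); lra. }
(* If y is too short for the homogeneous bound, then <S y, y> is at most d in
   absolute value by the choice of eta. *)
assert (Sy : - (4 * d) <= ip (S y) y).
{ destruct (Rle_dec (norm (D y)) (e0 * norm y)) as [a|a].
  - apply Rle_trans with (2 := lowS y a); generalize (norm_ge_0 y); intros p.
    assert (norm y ^ 2 <= 4) by nra; nra.
  - apply Rnot_le_lt in a.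
    assert (norm y <= eta) by (apply Rmult_le_reg_l with e0; lra).
    generalize (ip_cauchy_schwarz (S y) y) (Sc y) (norm_ge_0 y); intros b s p.
    apply Rabs_le_between in b.
    assert (norm (S y) * norm y <= c * norm y * norm y) by nra.
    assert (norm y ^ 2 <= eta ^ 2) by nra.
    assert (c * norm y * norm y <= d) by nra.
    lra. }
assert (Sy' : ip (S y) y = ip (S x) x - 2 * / c * norm (S x) ^ 2 + / c * / c * ip (S (S x)) (S x)).
{ unfold y; expand; rewrite (saS (S x) x), ip_self; ring. }
assert (SSx : / c * / c * ip (S (S x)) (S x) <= / c * norm (S x) ^ 2).
{ generalize (ip_cauchy_schwarz (S (S x)) (S x)) (Sc (S x)) (norm_ge_0 (S x)); intros b s p.
  apply Rabs_le_between in b.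
  assert (b' : ip (S (S x)) (S x) <= c * norm (S x) ^ 2) by nra.
  apply Rle_trans with (/ c * / c * (c * norm (S x) ^ 2)).
  - apply Rmult_le_compat_l; [nra | easy].
  - right; transitivity (/ c * c * (/ c * norm (S x) ^ 2)); [ring | rewrite icc; ring]. }
assert (fx : ip (S x) x <= d) by (rewrite formS, hx; lra).
assert (fin : norm (S x) ^ 2 <= e ^ 2).
{ rewrite <- dc.
  assert (h : / c * norm (S x) ^ 2 <= 5 * d) by lra.
  apply Rmult_le_compat_l with (r := c) in h; [|lra].
  replace (c * (/ c * norm (S x) ^ 2)) with (/ c * c * norm (S x) ^ 2) in h by ring.
  rewrite icc in h; lra. }
apply Rsqr_incr_0; [unfold Rsqr; lra | apply norm_ge_0 | lra].
Qed.

(** * Polynomials in an operator *)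

(** Pairs (p, p(T)) with p a real polynomial function.  Keeping the function and
    the operator together makes sums, products and compositions of polynomials
    available without handling coefficients. *)
Inductive poly_pair {H : Hilbert} (T : Op H) : (R -> R) -> Op H -> Prop :=
| poly_pair_const c : poly_pair T (fun _ => c) (scal c op_one)
| poly_pair_plus f g P Q : poly_pair T f P -> poly_pair T g Q ->
    poly_pair T (fun x => f x + g x) (plus P Q)
| poly_pair_mulx f P : poly_pair T f P -> poly_pair T (fun x => x * f x) (mult T P).

Lemma poly_pair_ext {H : Hilbert} (T : Op H) f g P Q :
  poly_pair T f P -> (forall x, f x = g x) -> P = Q -> poly_pair T g Q.
Proof.
intros h e <-; replace g with f; [easy|]; apply functional_extensionality, e.
Qed.

Lemma poly_pair_id {H : Hilbert} (T : Op H) : poly_pair T (fun x => x) T.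
Proof.
apply poly_pair_ext with (1 := poly_pair_mulx _ _ _ (poly_pair_const T 1)); [intros; ring | op_vec].
Qed.

Lemma poly_pair_scal {H : Hilbert} (T : Op H) r f P :
  poly_pair T f P -> poly_pair T (fun x => r * f x) (scal r P).
Proof.
induction 1 as [c|f g P Q _ IHf _ IHg|f P _ IH].
- apply poly_pair_ext with (1 := poly_pair_const T (r * c)); [easy | op_vec].
- apply poly_pair_ext with (1 := poly_pair_plus _ _ _ _ _ IHf IHg); [intros; ring | op_vec].
- apply poly_pair_ext with (1 := poly_pair_mulx _ _ _ IH); [intros; ring | op_vec].
Qed.

Lemma poly_pair_mult {H : Hilbert} (T : Op H) f g P Q :
  poly_pair T f P -> poly_pair T g Q -> poly_pair T (fun x => f x * g x) (mult P Q).
Proof.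
intros hf hg; induction hf as [c|f h P P' _ IHf _ IHg|f P _ IH].
- apply poly_pair_ext with (1 := poly_pair_scal _ c _ _ hg); [easy | op_vec].
- apply poly_pair_ext with (1 := poly_pair_plus _ _ _ _ _ IHf IHg); [intros; ring | op_vec].
- apply poly_pair_ext with (1 := poly_pair_mulx _ _ _ IH); [intros; ring | op_vec].
Qed.

Lemma poly_pair_minus {H : Hilbert} (T : Op H) f g P Q :
  poly_pair T f P -> poly_pair T g Q -> poly_pair T (fun x => f x - g x) (minus P Q).
Proof.
intros hf hg.
apply poly_pair_ext with (1 := poly_pair_plus _ _ _ _ _ hf (poly_pair_scal _ (-1) _ _ hg));
  [intros; ring | op_vec].
Qed.

Lemma poly_pair_comp {H : Hilbert} (T U : Op H) g f P :
  poly_pair T g U -> poly_pair U f P -> poly_pair T (fun x => f (g x)) P.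
Proof.
intros hg hf; induction hf as [c|f h P P' _ IHf _ IHg|f P _ IH].
- apply poly_pair_const.
- exact (poly_pair_plus _ _ _ _ _ IHf IHg).
- exact (poly_pair_mult _ _ _ _ _ hg IH).
Qed.

Lemma poly_pair_poly {H : Hilbert} (T : Op H) a n :
  poly_pair T (poly_eval a n) (poly_op a n T).
Proof.
assert (pw : forall k, poly_pair T (fun x => x ^ k) (pow_n T k)).
{ induction k as [|k IH].
  - apply poly_pair_ext with (1 := poly_pair_const T 1); [easy | simpl; op_vec].
  - exact (poly_pair_mulx _ _ _ IH). }
unfold poly_eval, poly_op; induction n as [|n IH].
- apply poly_pair_ext with (1 := poly_pair_scal _ (a 0%nat) _ _ (pw 0%nat));
    intros; now rewrite sum_O.
- apply poly_pair_ext with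
    (1 := poly_pair_plus _ _ _ _ _ IH (poly_pair_scal _ (a (S n)) _ _ (pw (S n))));
    intros; now rewrite sum_Sn.
Qed.

(** Conversion to the coefficient form.  The induction carries the vanishing of
    the coefficients beyond the degree, so that two polynomials can be written with
    a common degree before they are added. *)
Lemma poly_pair_coef {H : Hilbert} (T : Op H) f P : poly_pair T f P ->
  exists a n, (forall x, f x = poly_eval a n x) /\ P = poly_op a n T.
Proof.
intros hf.
assert (h : exists a n, (forall k, (n < k)%nat -> a k = 0) /\
          (forall x, f x = poly_eval a n x) /\ P = poly_op a n T).
2: { destruct h as [a [n h]]; now exists a, n. }
assert (ev : forall a n j x, (forall k, (n < k)%nat -> a k = 0) ->
          poly_eval a (n + j) x = poly_eval a n x).
{ intros a n j x h; induction j as [|j IH]; [now rewrite Nat.add_0_r|].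
  rewrite Nat.add_succ_r; unfold poly_eval in *; rewrite sum_Sn, IH, h by lia.
  unfold plus; simpl; ring. }
assert (op : forall a n j, (forall k, (n < k)%nat -> a k = 0) ->
          poly_op a (n + j) T = poly_op a n T).
{ intros a n j h; induction j as [|j IH]; [now rewrite Nat.add_0_r|].
  rewrite Nat.add_succ_r; unfold poly_op in *; rewrite sum_Sn, IH, h by lia.
  op_vec. }
induction hf as [c|f g P Q _ IHf _ IHg|f P _ IH].
- exists (fun k => match k with O => c | _ => 0 end), O; repeat split.
  + intros [|k]; [lia | easy].
  + intros x; unfold poly_eval; rewrite sum_O; ring.
  + unfold poly_op; now rewrite sum_O.
- destruct IHf as [a [n [az [ae ao]]]], IHg as [b [p [bz [be bo]]]].
  exists (fun k => a k + b k), (n + p)%nat; repeat split.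
  + intros k hk; rewrite az, bz by lia; ring.
  + intros x; rewrite ae, be, <- (ev a n p x az), <- (ev b p n x bz), (Nat.add_comm p n).
    unfold poly_eval; change (plus (sum_n (fun k => a k * x ^ k) (n + p))
      (sum_n (fun k => b k * x ^ k) (n + p)) = sum_n (fun k => (a k + b k) * x ^ k) (n + p)).
    rewrite <- sum_n_plus; apply sum_n_ext; intros k; unfold plus; simpl; ring.
  + rewrite ao, bo, <- (op a n p az), <- (op b p n bz), (Nat.add_comm p n).
    unfold poly_op; rewrite <- sum_n_plus; apply sum_n_ext; intros k; op_vec.
- destruct IH as [a [n [az [ae ao]]]].
  exists (fun k => match k with O => 0 | S k => a k end), (S n); repeat split.
  + intros [|k]; [lia | intros; apply az; lia].
  + intros x; rewrite ae; unfold poly_eval, sum_n.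
    rewrite (sum_Sn_m _ 0 (S n)) by lia; rewrite <- sum_n_m_S.
    transitivity (sum_n_m (fun k => mult (x : R_Ring) (a k * x ^ k)) 0 n);
      [symmetry; exact (sum_n_m_mult_l (x : R_Ring) (fun k => a k * x ^ k) 0 n)|].
    match goal with |- ?u = plus _ ?v => transitivity (0 * x ^ 0 + v); [|easy];
      rewrite Rmult_0_l, Rplus_0_l end.
    apply sum_n_m_ext; intros k; change (x * (a k * x ^ k) = a k * (x * x ^ k)); ring.
  + rewrite ao; unfold poly_op, sum_n.
    rewrite (sum_Sn_m _ 0 (S n)) by lia; rewrite <- sum_n_m_S.
    rewrite <- (sum_n_m_mult_l (T : Op_Ring H)).
    match goal with |- ?x = plus ?y ?z => transitivity z; [|op_vec] end.
    apply sum_n_m_ext; intros k.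
    change (mult T (scal (a k) (pow_n T k)) = scal (a k) (mult T (pow_n T k))); op_vec.
Qed.

Lemma poly_pair_self_adjoint {H : Hilbert} (T : Op H) f P :
  self_adjoint T -> poly_pair T f P ->
  (forall x, P (T x) = T (P x)) /\ self_adjoint P.
Proof.
intros sa; induction 1 as [c|f g P Q _ [cP sP] _ [cQ sQ]|f P _ [cP sP]].
- split; [intros x; vec|].
  apply self_adjoint_ip; intros x y; expand; ring.
- split; [intros x; expand; now rewrite cP, cQ|].
  apply self_adjoint_ip; intros x y; expand.
  now rewrite (proj1 (self_adjoint_ip P) sP), (proj1 (self_adjoint_ip Q) sQ).
- split; [intros x; expand; now rewrite cP|].
  apply self_adjoint_ip; intros x y; expand.
  now rewrite (proj1 (self_adjoint_ip T) sa), (proj1 (self_adjoint_ip P) sP), cP.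
Qed.

(** p(T) - p(l) is a multiple of T - l. *)
Lemma poly_pair_approx_eigenvector {H : Hilbert} (T : Op H) f P l :
  poly_pair T f P -> exists C, 0 <= C /\ forall x,
    norm (minus P (scal (f l) op_one) x) <= C * norm (minus T (scal l op_one) x).
Proof.
induction 1 as [c|f g P Q _ [C [hC hP]] _ [D [hD hQ]]|f P _ [C [hC hP]]].
- exists 0; split; [lra|]; intros x; rewrite Rmult_0_l; right.
  transitivity (norm (zero : H)); [f_equal; vec | apply hilb_norm_zero].
- exists (C + D); split; [lra|]; intros x.
  apply Rle_trans with
    (norm (plus (minus P (scal (f l) op_one) x) (minus Q (scal (g l) op_one) x)));
    [right; f_equal; vec|].
  rewrite Rmult_plus_distr_r; now apply hilb_norm_plus_le.
- generalize (op_norm_ge_0 T); intros hT.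
  exists (op_norm T * C + Rabs (f l)); split.
  { generalize (Rabs_pos (f l)); nra. }
  intros x.
  apply Rle_trans with
    (norm (plus (T (minus P (scal (f l) op_one) x)) (rscal (f l) (minus T (scal l op_one) x))));
    [right; f_equal; vec|].
  rewrite Rmult_plus_distr_r; apply hilb_norm_plus_le.
  + apply Rle_trans with (1 := op_norm_le T _); rewrite Rmult_assoc.
    apply Rmult_le_compat_l; [easy | apply hP].
  + rewrite norm_rscal; apply Rle_refl.
Qed.

Lemma eq_of_small_multiples (u C : R) : (forall e, 0 < e -> Rabs u <= C * e) -> u = 0.
Proof.
intros h; apply NNPP; intros nz.
assert (p : 0 < Rabs u) by now apply Rabs_pos_lt.
assert (q : 0 <= Rabs C) by apply Rabs_pos.
generalize (h (Rabs u / (2 * (Rabs C + 1))) ltac:(apply Rdiv_lt_0_compat; lra)).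
intros k.
assert (e : Rabs u / (2 * (Rabs C + 1)) * (2 * (Rabs C + 1)) = Rabs u) by (field; lra).
set (w := Rabs u / (2 * (Rabs C + 1))) in *.
assert (0 < w) by nra.
generalize (Rle_abs C); nra.
Qed.

Lemma op_norm_almost_attained {H : Hilbert} (P : Op H) e : 0 < e -> e < op_norm P ->
  exists x : H, norm x = 1 /\ op_norm P - e <= norm (P x).
Proof.
intros he hlt; apply NNPP; intros no.
assert (h : op_norm P <= op_norm P - e); [|lra].
apply op_norm_lub; intros x hx; apply Rnot_lt_le; intros lt; apply no.
destruct (Req_dec (norm x) 0) as [z|z].
{ generalize (hilb_norm_eq_zero x z); intros ->.
  rewrite op_app_zero, hilb_norm_zero in lt; lra. }
generalize (norm_ge_0 x); intros p.
assert (1 <= / norm x) by (rewrite <- Rinv_1; apply Rinv_le_contravar; lra).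
exists (rscal (/ norm x) x); rewrite op_app_rscal, !norm_rscal, Rabs_pos_eq by lra.
split; [now apply Rinv_l | nra].
Qed.

(** For a unit vector x and N the norm of P,
    |(N^2 - P^2) x|^2 = N^4 - 2 N^2 |P x|^2 + |P^2 x|^2 <= N^2 (N^2 - |P x|^2),
    which is small when |P x| is close to N. *)
Lemma op_norm_gap {H : Hilbert} (P : Op H) : self_adjoint P -> 0 < op_norm P ->
  forall e, 0 < e ->
  exists x, approx_null (minus (scal (op_norm P ^ 2) op_one) (mult P P)) e x.
Proof.
intros sa pos e he; set (N := op_norm P) in *.
assert (N3 : 0 < 2 * N ^ 3) by (generalize (pow_lt N 3 pos); lra).
(* N^2 (N^2 - (N - d)^2) <= 2 N^3 d, which is at most e^2 for this d. *)
set (d := Rmin (N / 2) (e ^ 2 / (2 * N ^ 3))).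
assert (d1 : d <= N / 2) by apply Rmin_l.
assert (d2 : 2 * N ^ 3 * d <= e ^ 2).
{ replace (e ^ 2) with (2 * N ^ 3 * (e ^ 2 / (2 * N ^ 3))) by (field; lra).
  apply Rmult_le_compat_l; [lra | apply Rmin_r]. }
assert (d0 : 0 < d).
{ apply Rmin_glb_lt; [lra|]; apply Rdiv_lt_0_compat; [now apply pow_lt | easy]. }
destruct (op_norm_almost_attained P d d0) as [x [hx Px]]; [unfold N in *; lra|].
fold N in Px.
exists x; split; [easy|].
set (D := minus (scal (N ^ 2) op_one) (mult P P)).
assert (eq : norm (D x) ^ 2 = N ^ 4 - 2 * N ^ 2 * norm (P x) ^ 2 + norm (P (P x)) ^ 2).
{ rewrite <- ip_self; unfold D; expand.
  rewrite (proj1 (self_adjoint_ip P) sa (P x) x), <- (proj1 (self_adjoint_ip P) sa x (P x)).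
  rewrite !ip_self, hx; ring. }
generalize (op_norm_le P (P x)) (op_norm_le P x) (norm_ge_0 (P x)) (norm_ge_0 (P (P x))).
fold N; rewrite hx; intros a b p q.
assert (u : norm (P (P x)) ^ 2 <= N ^ 2 * norm (P x) ^ 2).
{ rewrite <- Rpow_mult_distr; apply pow_incr; lra. }
assert (v : (N - d) ^ 2 <= norm (P x) ^ 2) by (apply pow_incr; lra).
assert (N2 : 0 < N ^ 2) by now apply pow_lt.
assert (w : N ^ 2 * (N - d) ^ 2 <= N ^ 2 * norm (P x) ^ 2) by (apply Rmult_le_compat_l; lra).
assert (z : 0 <= N ^ 2 * d ^ 2) by (generalize (pow2_ge_0 d); nra).
assert (r : norm (D x) ^ 2 <= e ^ 2).
{ rewrite eq; replace (N ^ 4) with (N ^ 2 * (N - d) ^ 2 + 2 * N ^ 3 * d - N ^ 2 * d ^ 2) by ring.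
  lra. }
apply Rsqr_incr_0; [unfold Rsqr; lra | apply norm_ge_0 | lra].
Qed.

(** The vectors supplied by [joint_approx_eigenvector] for D = N^2 - P^2 show
    that T - l has no bounded inverse and that N^2 - f(l)^2 = 0; their Rayleigh
    quotients tend to l, so every bound on T bounds l. *)
Lemma poly_norm_attained {H : Hilbert} (T : Op H) f P :
  self_adjoint T -> poly_pair T f P -> 0 < op_norm P ->
  exists l, spectrum T (RtoC l) /\ Rabs (f l) = op_norm P /\
    (forall lo, op_le (scal lo op_one) T -> lo <= l) /\
    (forall hi, op_le T (scal hi op_one) -> l <= hi).
Proof.
intros sa pf pos; set (N := op_norm P).
destruct (poly_pair_self_adjoint T f P sa pf) as [comm saP].
set (D := minus (scal (N ^ 2) op_one) (mult P P)).
assert (pD : poly_pair T (fun t => N ^ 2 - f t * f t) D).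
{ apply poly_pair_minus; [apply poly_pair_const | now apply poly_pair_mult]. }
destruct (joint_approx_eigenvector T D sa) as [l hl].
{ intros x; unfold D; vec; now rewrite !comm. }
{ exact (op_norm_gap P saP pos). }
assert (rayleigh : forall e x, norm x = 1 -> norm (minus T (scal l op_one) x) <= e ->
          Rabs (ip (T x) x - l) <= e).
{ intros e x hx ex; replace (ip (T x) x - l) with (ip (minus T (scal l op_one) x) x).
  - apply Rle_trans with (1 := ip_cauchy_schwarz _ x); rewrite hx; lra.
  - expand; rewrite ip_self, hx; ring. }
exists l; repeat split.
- intros [S [hS _]].
  generalize (op_norm_ge_0 S); intros pS.
  assert (q : 0 < / (op_norm S + 1)) by (apply Rinv_0_lt_compat; lra).
  destruct (hl (/ (op_norm S + 1)) q) as [x [[hx _] ex]].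
  assert (h : norm x <= op_norm S * / (op_norm S + 1)).
  { replace x with (S (minus T (scal l op_one) x)) at 1.
    - apply Rle_trans with (1 := op_norm_le S _); now apply Rmult_le_compat_l.
    - exact (f_equal (fun V : Op H => V x) hS). }
  rewrite hx in h.
  assert (op_norm S * / (op_norm S + 1) = 1 - / (op_norm S + 1)) by (field; lra).
  lra.
- destruct (poly_pair_approx_eigenvector T _ D l pD) as [C [hC evD]].
  assert (z : N ^ 2 - f l * f l = 0).
  { apply eq_of_small_multiples with (C + 1); intros e he.
    destruct (hl e he) as [x [[hx Dx] ex]].
    assert (h : norm (rscal (N ^ 2 - f l * f l) x) <= (C + 1) * e).
    { replace (rscal (N ^ 2 - f l * f l) x)
        with (minus (D x) (minus D (scal (N ^ 2 - f l * f l) op_one) x)) by vec.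
      replace ((C + 1) * e) with (e + C * e) by ring.
      apply (hilb_norm_minus_le H); [exact Dx|].
      apply Rle_trans with (1 := evD x); now apply Rmult_le_compat_l. }
    rewrite norm_rscal, hx in h; lra. }
  rewrite <- (Rabs_pos_eq N) by (unfold N; lra).
  apply Rsqr_eq_abs_0; unfold Rsqr; lra.
- intros lo h; apply le_epsilon; intros e he.
  destruct (hl e he) as [x [[hx _] ex]].
  generalize (op_le_ip _ _ h x) (rayleigh e x hx ex).
  expand; rewrite ip_self, hx; intros a b; apply Rabs_le_between in b; lra.
- intros hi h; apply le_epsilon; intros e he.
  destruct (hl e he) as [x [[hx _] ex]].
  generalize (op_le_ip _ _ h x) (rayleigh e x hx ex).
  expand; rewrite ip_self, hx; intros a b; apply Rabs_le_between in b; lra.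
Qed.

(** * Polynomial approximation *)

(** The expectation of g after n steps of a walk that starts at y and moves by h
    with probability q at each step.  This recursion gives the Bernstein polynomials
    in q without binomial coefficients. *)
Fixpoint bernstein (q h : R) (n : nat) (g : R -> R) (y : R) : R :=
  match n with
  | O => g y
  | S n => q * bernstein q h n g (y + h) + (1 - q) * bernstein q h n g y
  end.

Lemma bernstein_le q h n g1 g2 y : 0 <= q <= 1 -> 0 <= h ->
  (forall z, y <= z <= y + INR n * h -> g1 z <= g2 z) ->
  bernstein q h n g1 y <= bernstein q h n g2 y.
Proof.
intros hq hh; revert y; induction n as [|n IH]; intros y le.
- apply le; simpl; lra.
- rewrite S_INR in le; generalize (pos_INR n); intros hn; simpl.
  apply Rplus_le_compat; apply Rmult_le_compat_l; try lra; apply IH; intros z hz;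
    apply le; nra.
Qed.

(** Mean and variance of the walk. *)
Lemma bernstein_quadratic q h n a k c y :
  bernstein q h n (fun z => a + k * (z - c) ^ 2) y
  = a + k * ((y + INR n * h * q - c) ^ 2 + INR n * h ^ 2 * (q * (1 - q))).
Proof.
revert y; induction n as [|n IH]; intros y.
- simpl; ring.
- rewrite S_INR; simpl bernstein; rewrite !IH; ring.
Qed.

Lemma bernstein_poly {H : Hilbert} (T : Op H) q Q h n g y :
  poly_pair T q Q -> exists P, poly_pair T (fun x => bernstein (q x) h n g y) P.
Proof.
intros hq; revert y; induction n as [|n IH]; intros y.
- eexists; apply (poly_pair_const T (g y)).
- destruct (IH (y + h)) as [P hP], (IH y) as [P' hP'].
  eexists; simpl; apply poly_pair_plus; apply poly_pair_mult; try eassumption.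
  apply poly_pair_minus; [apply poly_pair_const | eassumption].
Qed.

(** Uniform continuity controls the points close to x; for the others the
    oscillation B of f is absorbed by B / d^2 times the squared distance. *)
Lemma continuous_quadratic_modulus f lo hi e : lo <= hi -> 0 < e ->
  (forall x, lo <= x <= hi -> continuity_pt f x) ->
  exists k, 0 < k /\ forall x z, lo <= x <= hi -> lo <= z <= hi ->
    Rabs (f z - f x) <= e + k * (z - x) ^ 2.
Proof.
intros lohi he cf.
destruct (Heine_cor2 cf (mkposreal e he)) as [d hd]; simpl in hd.
destruct (continuity_ab_maj f lo hi lohi cf) as [u [hu _]].
destruct (continuity_ab_min f lo hi lohi cf) as [v [hv _]].
set (B := f u - f v + 1).
assert (hB : 0 < B).
{ unfold B; generalize (hu lo ltac:(lra)) (hv lo ltac:(lra)); lra. }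
assert (d2 : 0 < d ^ 2) by (apply pow_lt, cond_pos).
exists (B / d ^ 2); split; [now apply Rdiv_lt_0_compat|].
intros x z hx hz.
assert (k0 : 0 < B / d ^ 2) by now apply Rdiv_lt_0_compat.
destruct (Rlt_dec (Rabs (z - x)) d) as [lt|ge].
- generalize (hd z x hz hx lt) (pow2_ge_0 (z - x)); nra.
- apply Rnot_lt_le in ge.
  assert (a : d ^ 2 <= (z - x) ^ 2).
  { rewrite <- (pow2_abs (z - x)); apply pow_incr; generalize (cond_pos d); lra. }
  assert (b : B <= B / d ^ 2 * (z - x) ^ 2).
  { replace B with (B / d ^ 2 * d ^ 2) at 1 by (field; apply Rgt_not_eq, cond_pos).
    apply Rmult_le_compat_l; lra. }
  apply Rle_trans with B; [|lra].
  unfold B; apply Rabs_le; generalize (hu x hx) (hu z hz) (hv x hx) (hv z hz); lra.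
Qed.

(** For x in [lo, hi], n steps of length (hi - lo) / n taken with probability
    (x - lo) / (hi - lo) lead from lo to x on average, with variance at most
    (hi - lo)^2 / n.  The quadratic modulus of f turns this variance into a bound
    on the error. *)
Lemma weierstrass {H : Hilbert} (T : Op H) f lo hi e : lo < hi -> 0 < e ->
  (forall x, lo <= x <= hi -> continuity_pt f x) ->
  exists p P, poly_pair T p P /\ forall x, lo <= x <= hi -> Rabs (p x - f x) <= e.
Proof.
intros lohi he cf.
destruct (continuous_quadratic_modulus f lo hi (e / 2) (Rlt_le _ _ lohi) ltac:(lra) cf)
  as [k [hk mod_f]].
set (w := hi - lo); assert (hw : 0 < w) by (unfold w; lra).
assert (kw : 0 < k * w ^ 2) by (apply Rmult_lt_0_compat; [easy | now apply pow_lt]).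
destruct (archimed_cor1 (e / 2 / (k * w ^ 2))) as [n [hn n0]].
{ apply Rdiv_lt_0_compat; lra. }
assert (Nn : 0 < INR n) by now apply lt_0_INR.
set (h := w / INR n).
assert (nh : INR n * h = w) by (unfold h; field; lra).
assert (hh : 0 < h) by now apply Rdiv_lt_0_compat.
assert (var : k * (INR n * h ^ 2) <= e / 2).
{ replace (INR n * h ^ 2) with (w ^ 2 * / INR n) by (unfold h; field; lra).
  rewrite <- Rmult_assoc; replace (e / 2) with (k * w ^ 2 * (e / 2 / (k * w ^ 2)))
    by (field; lra).
  apply Rmult_le_compat_l; lra. }
set (q := fun x => / w * (x - lo)).
assert (hq : exists Q, poly_pair T q Q).
{ eexists; apply poly_pair_scal, poly_pair_minus; [apply poly_pair_id | apply poly_pair_const]. }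
destruct hq as [Q hq].
destruct (bernstein_poly T q Q h n f lo hq) as [P hP].
exists (fun x => bernstein (q x) h n f lo), P; split; [easy|]; intros x hx.
assert (iw : 0 < / w) by now apply Rinv_0_lt_compat.
assert (wq : w * q x = x - lo) by (unfold q; field; lra).
assert (hqx : 0 <= q x <= 1) by (unfold w in *; nra).
assert (v : k * (INR n * h ^ 2 * (q x * (1 - q x))) <= e / 2).
{ assert (q x * (1 - q x) <= 1) by nra.
  assert (0 <= k * (INR n * h ^ 2)).
  { apply Rmult_le_pos; [lra|]; apply Rmult_le_pos; [lra | apply pow2_ge_0]. }
  nra. }
assert (zero_mean : lo + INR n * h * q x - x = 0) by (rewrite nh; lra).
assert (up : bernstein (q x) h n f lo <=
  bernstein (q x) h n (fun z => (f x + e / 2) + k * (z - x) ^ 2) lo).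
{ apply bernstein_le; [easy | lra|]; intros z hz.
  generalize (mod_f x z hx ltac:(rewrite nh in hz; unfold w in hz; lra)).
  intros m; apply Rabs_le_between in m; lra. }
assert (down : bernstein (q x) h n (fun z => (f x - e / 2) + (- k) * (z - x) ^ 2) lo <=
  bernstein (q x) h n f lo).
{ apply bernstein_le; [easy | lra|]; intros z hz.
  generalize (mod_f x z hx ltac:(rewrite nh in hz; unfold w in hz; lra)).
  intros m; apply Rabs_le_between in m; lra. }
rewrite bernstein_quadratic, zero_mean in up, down.
apply Rabs_le; lra.
Qed.

(** * Functional calculus on an interval *)

Definition sa_between {H : Hilbert} (T : Op H) (lo hi : R) : Prop :=
  self_adjoint T /\ op_le (scal lo op_one) T /\ op_le T (scal hi op_one).

Lemma poly_norm_le_spectrum {H : Hilbert} (T : Op H) p P c :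
  self_adjoint T -> poly_pair T p P -> 0 <= c ->
  (forall x, spectrum T (RtoC x) -> Rabs (p x) <= c) -> op_norm P <= c.
Proof.
intros sa hp hc b; destruct (Rle_dec (op_norm P) 0) as [n|n]; [lra|].
destruct (poly_norm_attained T p P sa hp ltac:(lra)) as [l [sl [<- _]]]; now apply b.
Qed.

Lemma poly_norm_le {H : Hilbert} (T : Op H) lo hi p P c :
  sa_between T lo hi -> poly_pair T p P -> 0 <= c ->
  (forall x, lo <= x <= hi -> Rabs (p x) <= c) -> op_norm P <= c.
Proof.
intros [sa [hlo hhi]] hp hc b; destruct (Rle_dec (op_norm P) 0) as [n|n]; [lra|].
destruct (poly_norm_attained T p P sa hp ltac:(lra)) as [l [_ [<- [a1 a2]]]].
apply b; split; [now apply a1 | now apply a2].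
Qed.

Lemma poly_bounded {H : Hilbert} (T : Op H) p P lo hi : poly_pair T p P ->
  exists B, 0 <= B /\ forall x, lo <= x <= hi -> Rabs (p x) <= B.
Proof.
induction 1 as [c|f g P Q _ [B [hB bf]] _ [B' [hB' bg]]|f P _ [B [hB bf]]].
- exists (Rabs c); split; [apply Rabs_pos | intros; apply Rle_refl].
- exists (B + B'); split; [lra|]; intros x hx.
  apply Rle_trans with (1 := Rabs_triang _ _); generalize (bf x hx) (bg x hx); lra.
- exists ((Rabs lo + Rabs hi) * B); split.
  + apply Rmult_le_pos; [|easy]; generalize (Rabs_pos lo) (Rabs_pos hi); lra.
  + intros x hx; rewrite Rabs_mult; apply Rmult_le_compat; try apply Rabs_pos; [|now apply bf].
    apply Rabs_le; generalize (Rle_abs hi) (Rabs_pos hi) (Rabs_pos lo) (Rabs_maj2 lo); lra.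
Qed.

(** If 0 <= p <= N on [lo, hi], then N - p has sup norm at most N there, so
    N - P has norm at most N, and hence P is nonnegative. *)
Lemma poly_nonneg {H : Hilbert} (T : Op H) lo hi p P : lo <= hi ->
  sa_between T lo hi -> poly_pair T p P ->
  (forall x, lo <= x <= hi -> 0 <= p x) -> forall x, 0 <= ip (P x) x.
Proof.
intros lohi hT hp p0 x.
destruct (poly_bounded T p P lo hi hp) as [N [hN bN]].
assert (h : op_norm (minus (scal N op_one) P) <= N).
{ apply (poly_norm_le T lo hi (fun t => N - p t)); try easy.
  - apply poly_pair_minus; [apply poly_pair_const | easy].
  - intros t ht; generalize (bN t ht) (p0 t ht); intros a b.
    apply Rabs_le_between in a; apply Rabs_le; lra. }
generalize (op_form_bound (minus (scal N op_one) P) x); expand; rewrite ip_self.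
generalize (pow2_ge_0 (norm x)); intros a b; apply Rabs_le_between in b; nra.
Qed.

(** Y = f(T), for f known on [lo, hi] only.  Unlike [is_cfc], the approximation
    is on an interval containing the spectrum and not on the spectrum itself, so
    that statements about f(T) do not depend on a description of the spectrum. *)
Definition interval_calculus {H : Hilbert} (T : Op H) (lo hi : R) (f : R -> R) (Y : Op H) : Prop :=
  forall e, 0 < e -> exists p P, poly_pair T p P /\
    (forall x, lo <= x <= hi -> Rabs (p x - f x) <= e) /\ op_norm (minus P Y) <= e.

Lemma op_norm_minus_sym {H : Hilbert} (S T : Op H) : op_norm (minus S T) = op_norm (minus T S).
Proof. rewrite <- (op_norm_opp (minus T S)); f_equal; op_vec. Qed.

Lemma op_norm_dist {H : Hilbert} (S T U : Op H) :
  op_norm (minus S U) <= op_norm (minus S T) + op_norm (minus T U).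
Proof.
apply Rle_trans with (2 := op_norm_plus _ _); right; f_equal; op_vec.
Qed.

Lemma op_norm_minus_eq_0 {H : Hilbert} (S T : Op H) : op_norm (minus S T) = 0 -> S = T.
Proof.
intros h; apply op_norm_eq_0 in h; apply op_ext; intros x; apply ip_ext; intros v.
generalize (f_equal (fun V : Op H => ip (V x) v) h); simpl.
change (ip (minus (S x) (T x)) v = ip zero v -> ip (S x) v = ip (T x) v); expand; lra.
Qed.

Lemma calculus_poly {H : Hilbert} (T : Op H) lo hi p P :
  poly_pair T p P -> interval_calculus T lo hi p P.
Proof.
intros hp e he; exists p, P; repeat split; [easy| |].
- intros x _; rewrite Rminus_diag, Rabs_R0; lra.
- replace (minus P P) with (zero : Op H) by op_vec; rewrite op_norm_zero; lra.
Qed.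

Lemma calculus_dist {H : Hilbert} (T : Op H) lo hi f g Y Z c :
  sa_between T lo hi -> interval_calculus T lo hi f Y -> interval_calculus T lo hi g Z -> 0 <= c ->
  (forall x, lo <= x <= hi -> Rabs (f x - g x) <= c) -> op_norm (minus Y Z) <= c.
Proof.
intros hT hf hg hc d; apply le_epsilon; intros e he.
destruct (hf (e / 4) ltac:(lra)) as [p [P [hp [ap nP]]]].
destruct (hg (e / 4) ltac:(lra)) as [q [Q [hq [aq nQ]]]].
assert (nPQ : op_norm (minus P Q) <= c + e / 2).
{ apply (poly_norm_le T lo hi (fun x => p x - q x)); [easy | now apply poly_pair_minus | lra |].
  intros x hx; generalize (ap x hx) (aq x hx) (d x hx); intros a1 a2 a3.
  apply Rabs_le_between in a1, a2, a3; apply Rabs_le; lra. }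
generalize (op_norm_dist Y P Z) (op_norm_dist P Q Z); rewrite (op_norm_minus_sym Y P); lra.
Qed.

Lemma calculus_unique {H : Hilbert} (T : Op H) lo hi f g Y Z :
  sa_between T lo hi -> interval_calculus T lo hi f Y -> interval_calculus T lo hi g Z ->
  (forall x, lo <= x <= hi -> f x = g x) -> Y = Z.
Proof.
intros hT hf hg e.
apply op_norm_minus_eq_0, Rle_antisym; [|apply op_norm_ge_0].
apply (calculus_dist T lo hi f g _ _ _ hT hf hg); [lra|].
intros x hx; rewrite e, Rminus_diag, Rabs_R0 by easy; lra.
Qed.

Lemma inv_succ_pos n : 0 < / INR (S n).
Proof. apply Rinv_0_lt_compat, lt_0_INR; lia. Qed.

Lemma inv_succ_small e : 0 < e -> eventually (fun n => / INR (S n) < e).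
Proof.
intros he; destruct (archimed_cor1 e he) as [N [hN N0]]; exists N; intros n hn.
apply Rle_lt_trans with (2 := hN); apply Rinv_le_contravar.
- now apply lt_0_INR.
- apply le_INR; lia.
Qed.

(** Polynomials converging uniformly to f on [lo, hi] form a Cauchy sequence in
    operator norm after substituting T. *)
Lemma calculus_exists {H : Hilbert} (T : Op H) lo hi f : lo < hi -> sa_between T lo hi ->
  (forall x, lo <= x <= hi -> continuity_pt f x) -> exists Y, interval_calculus T lo hi f Y.
Proof.
intros lohi hT cf.
assert (ch : forall n, exists V : (R -> R) * Op H, poly_pair T (fst V) (snd V) /\
          forall x, lo <= x <= hi -> Rabs (fst V x - f x) <= / INR (S n)).
{ intros n; destruct (weierstrass T f lo hi _ lohi (inv_succ_pos n) cf) as [p [P h]].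
  now exists (p, P). }
set (V := fun n => proj1_sig (constructive_indefinite_description _ (ch n))).
assert (hV : forall n, poly_pair T (fst (V n)) (snd (V n)) /\
          forall x, lo <= x <= hi -> Rabs (fst (V n) x - f x) <= / INR (S n)).
{ intros n; exact (proj2_sig (constructive_indefinite_description _ (ch n))). }
destruct (proj1 (filterlim_locally_cauchy (F := eventually) (fun n => snd (V n)))) as [Y hY].
{ intros e; exists (fun n => / INR (S n) < e / 4); split.
  - apply inv_succ_small; generalize (cond_pos e); lra.
  - intros u v hu hv; change (op_norm (minus (snd (V v)) (snd (V u))) < e).
    apply Rle_lt_trans with (e / 2); [|generalize (cond_pos e); lra].
    apply (poly_norm_le T lo hi (fun x => fst (V v) x - fst (V u) x)); try easy.
    + apply poly_pair_minus; apply hV.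
    + generalize (cond_pos e); lra.
    + intros x hx; generalize (proj2 (hV u) x hx) (proj2 (hV v) x hx); intros a b.
      apply Rabs_le_between in a, b; apply Rabs_le; lra. }
exists Y; intros e he.
generalize (proj1 (filterlim_locally _ _) hY (mkposreal e he)); intros near.
destruct (filter_ex _ (filter_and _ _ near (inv_succ_small e he))) as [n [a b]].
exists (fst (V n)), (snd (V n)); repeat split; [apply hV | | exact (Rlt_le _ _ a)].
intros x hx; apply Rle_trans with (1 := proj2 (hV n) x hx); lra.
Qed.

Lemma calculus_mult_poly {H : Hilbert} (T : Op H) lo hi f Y g Q :
  interval_calculus T lo hi f Y -> poly_pair T g Q ->
  interval_calculus T lo hi (fun x => g x * f x) (mult Q Y) /\
  interval_calculus T lo hi (fun x => f x * g x) (mult Y Q).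
Proof.
intros hf hg; destruct (poly_bounded T g Q lo hi hg) as [B [hB bB]].
generalize (op_norm_ge_0 Q); intros nQ.
assert (key : forall e, 0 < e -> exists p P, poly_pair T p P /\
  (forall x, lo <= x <= hi -> Rabs (g x) * Rabs (p x - f x) <= e) /\
  op_norm Q * op_norm (minus P Y) <= e).
{ intros e he; set (c := B + op_norm Q + 1).
  assert (hc : 0 < e / c) by (apply Rdiv_lt_0_compat; unfold c; lra).
  assert (ec : c * (e / c) = e) by (field; unfold c; lra).
  destruct (hf (e / c) hc) as [p [P [hp [ap nP]]]].
  exists p, P; repeat split; [easy| |].
  - intros x hx; rewrite <- ec; apply Rmult_le_compat; try apply Rabs_pos; [|now apply ap].
    generalize (bB x hx); unfold c; lra.
  - rewrite <- ec; apply Rmult_le_compat; try apply op_norm_ge_0; [|easy]; unfold c; lra. }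
split; intros e he; destruct (key e he) as [p [P [hp [ap nP]]]].
- exists (fun x => g x * p x), (mult Q P); repeat split; [now apply poly_pair_mult| |].
  + intros x hx; rewrite <- Rmult_minus_distr_l, Rabs_mult; now apply ap.
  + apply Rle_trans with (2 := nP); apply Rle_trans with (2 := op_norm_mult _ _).
    right; f_equal; op_vec.
- exists (fun x => p x * g x), (mult P Q); repeat split; [now apply poly_pair_mult| |].
  + intros x hx; rewrite <- Rmult_minus_distr_r, Rabs_mult, Rmult_comm; now apply ap.
  + apply Rle_trans with (2 := nP); rewrite Rmult_comm.
    apply Rle_trans with (2 := op_norm_mult _ _); right; f_equal; op_vec.
Qed.

Lemma calculus_scal {H : Hilbert} (T : Op H) lo hi f Y r :
  interval_calculus T lo hi f Y -> interval_calculus T lo hi (fun x => r * f x) (scal r Y).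
Proof.
intros hf.
replace (scal r Y) with (mult (scal r op_one : Op H) Y) by op_vec.
apply (calculus_mult_poly T lo hi f Y (fun _ => r)); [easy | apply poly_pair_const].
Qed.

Lemma calculus_comp {H : Hilbert} (T U : Op H) lo hi lo' hi' g f Y :
  poly_pair T g U -> (forall x, lo <= x <= hi -> lo' <= g x <= hi') ->
  interval_calculus U lo' hi' f Y -> interval_calculus T lo hi (fun x => f (g x)) Y.
Proof.
intros hg rg hf e he; destruct (hf e he) as [p [P [hp [ap nP]]]].
exists (fun x => p (g x)), P; repeat split; [now apply poly_pair_comp with U | | easy].
intros x hx; now apply ap, rg.
Qed.

Lemma op_form_close {H : Hilbert} (P Y : Op H) e x y : op_norm (minus P Y) <= e ->
  Rabs (ip (P x) y - ip (Y x) y) <= e * (norm x * norm y).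
Proof.
intros h; replace (ip (P x) y - ip (Y x) y) with (ip (minus P Y x) y) by (expand; ring).
apply Rle_trans with (1 := ip_cauchy_schwarz _ _).
rewrite <- Rmult_assoc; apply Rmult_le_compat_r; [apply norm_ge_0|].
apply Rle_trans with (1 := op_norm_le _ x).
apply Rmult_le_compat_r; [apply norm_ge_0 | easy].
Qed.

Lemma calculus_self_adjoint {H : Hilbert} (T : Op H) lo hi f Y :
  sa_between T lo hi -> interval_calculus T lo hi f Y -> self_adjoint Y.
Proof.
intros [sa _] hf; apply self_adjoint_ip; intros x y.
apply Rminus_diag_uniq, eq_of_small_multiples with (2 * (norm x * norm y)); intros e he.
destruct (hf e he) as [p [P [hp [_ nP]]]].
destruct (poly_pair_self_adjoint T p P sa hp) as [_ sP].
generalize (op_form_close P Y e x y nP) (op_form_close P Y e y x nP); intros a b.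
rewrite (ip_sym (P y)), (ip_sym (Y y)), <- (proj1 (self_adjoint_ip P) sP) in b.
apply Rabs_le_between in a, b; apply Rabs_le; lra.
Qed.

Lemma calculus_le {H : Hilbert} (T : Op H) lo hi f g Y Z : lo <= hi ->
  sa_between T lo hi -> interval_calculus T lo hi f Y -> interval_calculus T lo hi g Z ->
  (forall x, lo <= x <= hi -> f x <= g x) -> op_le Y Z.
Proof.
intros lohi hT hf hg le; apply positive_ip.
{ intros x y; expand.
  rewrite (proj1 (self_adjoint_ip Y) (calculus_self_adjoint _ _ _ _ _ hT hf)).
  now rewrite (proj1 (self_adjoint_ip Z) (calculus_self_adjoint _ _ _ _ _ hT hg)). }
intros x; expand; apply Rge_le, Rge_minus, Rle_ge, le_epsilon; intros e he.
set (c := 4 * (norm x ^ 2 + 1)).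
assert (hc : 0 < c) by (unfold c; generalize (pow2_ge_0 (norm x)); lra).
set (d := e / c); assert (hd : 0 < d) by now apply Rdiv_lt_0_compat.
assert (dc : 4 * d * (norm x ^ 2 + 1) = e).
{ unfold d; fold c; unfold c; field; generalize (pow2_ge_0 (norm x)); lra. }
destruct (hf d hd) as [p [P [hp [ap nP]]]].
destruct (hg d hd) as [q [Q [hq [aq nQ]]]].
generalize (op_form_close P Y d x x nP) (op_form_close Q Z d x x nQ); intros a b.
assert (pos : 0 <= ip (plus (minus Q P) (scal (2 * d) op_one) x) x).
{ apply (poly_nonneg T lo hi (fun t => (q t - p t) + 2 * d)); try easy.
  - apply poly_pair_plus; [now apply poly_pair_minus | apply poly_pair_const].
  - intros t ht; generalize (ap t ht) (aq t ht) (le t ht); intros u v w.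
    apply Rabs_le_between in u, v; lra. }
revert pos; expand; rewrite ip_self; intros pos.
apply Rabs_le_between in a, b; lra.
Qed.

Lemma calculus_inverse {H : Hilbert} (T : Op H) lo hi l Y : sa_between T lo hi ->
  (forall x, lo <= x <= hi -> x - l <> 0) ->
  interval_calculus T lo hi (fun x => / (x - l)) Y -> is_op_inv (minus T (scal l op_one)) Y.
Proof.
intros hT nz hY.
assert (lin : poly_pair T (fun x => x - l) (minus T (scal l op_one))).
{ apply poly_pair_minus; [apply poly_pair_id | apply poly_pair_const]. }
assert (un : interval_calculus T lo hi (fun _ => 1) op_one).
{ apply calculus_poly; apply poly_pair_ext with (1 := poly_pair_const T 1); [easy | op_vec]. }
destruct (calculus_mult_poly T lo hi _ Y _ _ hY lin) as [a b].
split.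
- apply (calculus_unique T lo hi _ _ _ _ hT b un); intros x hx; now apply Rinv_l, nz.
- apply (calculus_unique T lo hi _ _ _ _ hT a un); intros x hx; now apply Rinv_r, nz.
Qed.

(** For l outside [lo, hi] the function 1 / (x - l) is continuous on [lo, hi],
    and its value at T inverts T - l. *)
Lemma spectrum_between {H : Hilbert} (T : Op H) lo hi l : lo < hi ->
  sa_between T lo hi -> spectrum T (RtoC l) -> lo <= l <= hi.
Proof.
intros lohi hT sp; apply NNPP; intros out; apply sp.
assert (nz : forall x, lo <= x <= hi -> x - l <> 0).
{ intros x hx e; apply out; lra. }
destruct (calculus_exists T lo hi (fun x => / (x - l)) lohi hT) as [Y hY].
{ intros x hx; apply continuity_pt_inv; [|now apply nz].
  apply continuity_pt_minus; [apply continuity_pt_id | now apply continuity_pt_const]. }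
exists Y; exact (calculus_inverse T lo hi l Y hT nz hY).
Qed.

Lemma calculus_is_cfc {H : Hilbert} (T : Op H) lo hi f Y : lo < hi ->
  sa_between T lo hi -> interval_calculus T lo hi f Y -> is_cfc f T Y.
Proof.
intros lohi hT hf.
assert (ch : forall n, exists V : (nat -> R) * nat,
  (forall x, lo <= x <= hi -> Rabs (poly_eval (fst V) (snd V) x - f x) <= / INR (S n)) /\
  op_norm (minus (poly_op (fst V) (snd V) T) Y) <= / INR (S n)).
{ intros n; destruct (hf _ (inv_succ_pos n)) as [p [P [hp [ap nP]]]].
  destruct (poly_pair_coef T p P hp) as [a [d [ea eo]]].
  exists (a, d); simpl; split; [|now rewrite <- eo].
  intros x hx; rewrite <- ea; now apply ap. }
set (V := fun n => proj1_sig (constructive_indefinite_description _ (ch n))).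
assert (hV : forall n,
  (forall x, lo <= x <= hi -> Rabs (poly_eval (fst (V n)) (snd (V n)) x - f x) <= / INR (S n)) /\
  op_norm (minus (poly_op (fst (V n)) (snd (V n)) T) Y) <= / INR (S n)).
{ intros n; exact (proj2_sig (constructive_indefinite_description _ (ch n))). }
exists (fun n => fst (V n)), (fun n => snd (V n)); split.
- intros e; apply filter_imp with (2 := inv_succ_small e (cond_pos e)); intros n hn x sx.
  apply Rle_lt_trans with (2 := hn); apply hV; now apply (spectrum_between T).
- apply filterlim_locally; intros e.
  apply filter_imp with (2 := inv_succ_small e (cond_pos e)); intros n hn.
  apply Rle_lt_trans with (2 := hn); apply hV.
Qed.

(** Uniqueness needs the norm bound over the spectrum, since the two sequences of
    polynomials are compared only there. *)
Lemma is_cfc_unique {H : Hilbert} (f : R -> R) (T Y Z : Op H) :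
  self_adjoint T -> is_cfc f T Y -> is_cfc f T Z -> Y = Z.
Proof.
intros sa [a [n [ua la]]] [b [k [ub lb]]].
apply op_norm_minus_eq_0, eq_of_small_multiples with 4; intros e he.
  generalize (ua (mkposreal e he)) (ub (mkposreal e he))
    (proj1 (filterlim_locally _ _) la (mkposreal e he))
    (proj1 (filterlim_locally _ _) lb (mkposreal e he)); intros h1 h2 h3 h4.
  destruct (filter_ex _ (filter_and _ _ (filter_and _ _ h1 h2) (filter_and _ _ h3 h4)))
    as [i [[p1 p2] [p3 p4]]]; simpl in p1, p2.
  set (P := poly_op (a i) (n i) T) in *; set (Q := poly_op (b i) (k i) T) in *.
  change (op_norm (minus P Y) < e) in p3; change (op_norm (minus Q Z) < e) in p4.
  assert (nPQ : op_norm (minus P Q) <= 2 * e).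
  { apply (poly_norm_le_spectrum T (fun x => poly_eval (a i) (n i) x - poly_eval (b i) (k i) x));
      [easy | apply poly_pair_minus; apply poly_pair_poly | lra |].
    intros x sx; generalize (p1 x sx) (p2 x sx); intros u v.
    apply Rabs_lt_between in u, v; apply Rabs_le; lra. }
  rewrite Rabs_pos_eq by apply op_norm_ge_0.
  generalize (op_norm_dist Y P Z) (op_norm_dist P Q Z); rewrite (op_norm_minus_sym Y P); lra.
Qed.

Lemma cfc_eq {H : Hilbert} (T : Op H) lo hi f Y : lo < hi ->
  sa_between T lo hi -> interval_calculus T lo hi f Y -> cfc f T = Y.
Proof.
intros lohi hT hf.
assert (h : is_cfc f T Y) by now apply calculus_is_cfc with lo hi.
apply (is_cfc_unique f T); [apply hT | | easy].
unfold cfc; apply (iota_correct (is_cfc f T)); exists Y; split; [easy|].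
intros Z hZ; apply (is_cfc_unique f T); [apply hT | easy | easy].
Qed.

Lemma op_inv_eq {H : Hilbert} (T Y : Op H) : is_op_inv T Y -> op_inv T = Y.
Proof.
intros h.
assert (un : forall Z, is_op_inv T Z -> Z = Y).
{ intros Z [hZ _]; destruct h as [_ hY]; apply op_ext; intros x.
  generalize (f_equal (fun V : Op H => V (Y x)) hZ) (f_equal (fun V : Op H => V x) hY).
  intros a b; transitivity (Z (T (Y x))); [f_equal; symmetry; exact b | exact a]. }
apply un; unfold op_inv; apply (iota_correct (is_op_inv T)); exists Y; split; [easy|].
intros Z hZ; symmetry; now apply un.
Qed.

(** * Power means of two numbers *)

Lemma lipschitz_of_derive (f df : R -> R) (C a b : R) :
  (forall x, Rmin a b <= x <= Rmax a b -> is_derive f x (df x) /\ Rabs (df x) <= C) ->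
  Rabs (f b - f a) <= C * Rabs (b - a).
Proof.
intros h; destruct (MVT_gen f a b df) as [c [hc ->]].
- intros x hx; apply h; lra.
- intros x hx; apply continuity_pt_filterlim, (ex_derive_continuous f x).
  exists (df x); now apply h.
- rewrite Rabs_mult; apply Rmult_le_compat_r; [apply Rabs_pos | now apply h].
Qed.

(** k t / t for a function k with derivative k1 and k 0 = 0, extended by its
    limit k1 0; the constant extension to negative t gives a function continuous on
    the whole line. *)
Definition quotient_at_0 (k k1 : R -> R) (t : R) : R :=
  if Rle_dec t 0 then k1 0 else k t / t.

(** By the mean value theorem k t / t = k1 c with 0 <= c <= t, so the derivative
    (k1 t - k1 c) / t of the quotient is bounded by the bound C on k2. *)
Lemma quotient_at_0_lipschitz (k k1 k2 : R -> R) (C : R) : k 0 = 0 ->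
  (forall t, is_derive k t (k1 t)) -> (forall t, is_derive k1 t (k2 t)) ->
  (forall t, Rabs (k2 t) <= C) -> forall s t,
  Rabs (quotient_at_0 k k1 t - quotient_at_0 k k1 s) <= C * Rabs (t - s).
Proof.
intros k0 d1 d2 b2.
assert (hC : 0 <= C) by (generalize (b2 0) (Rabs_pos (k2 0)); lra).
assert (lip1 : forall s t, Rabs (k1 t - k1 s) <= C * Rabs (t - s)).
{ intros s t; apply (lipschitz_of_derive k1 k2); intros x _; split; [apply d2 | apply b2]. }
assert (mean : forall t, 0 < t -> exists c, 0 <= c <= t /\ k t = k1 c * t).
{ intros t ht; destruct (MVT_gen k 0 t k1) as [c [hc e]].
  - intros x _; apply d1.
  - intros x _; apply continuity_pt_filterlim, (ex_derive_continuous k x); now exists (k1 x).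
  - rewrite Rmin_left, Rmax_right in hc by lra; exists c; split; [easy|].
    rewrite k0 in e; lra. }
assert (ordered : forall s t, s <= t ->
  Rabs (quotient_at_0 k k1 t - quotient_at_0 k k1 s) <= C * Rabs (t - s)).
{ intros s t st; unfold quotient_at_0.
  destruct (Rle_dec t 0) as [t0|t0]; destruct (Rle_dec s 0) as [s0|s0]; try lra.
  - rewrite Rminus_diag, Rabs_R0; apply Rmult_le_pos; [easy | apply Rabs_pos].
  - destruct (mean t ltac:(lra)) as [c [hc ->]].
    replace (k1 c * t / t) with (k1 c) by (field; lra).
    apply Rle_trans with (1 := lip1 0 c); apply Rmult_le_compat_l; [easy|].
    rewrite !Rabs_pos_eq; lra.
  - apply (lipschitz_of_derive (fun u => k u / u) (fun u => (u * k1 u - k u) / u ^ 2)).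
    rewrite Rmin_left, Rmax_right by lra; intros u hu; split.
    + evar_last.
      * apply is_derive_div; [apply d1 | apply is_derive_id | lra].
      * change ((k1 u * u - k u * 1) / u ^ 2 = (u * k1 u - k u) / u ^ 2).
        field; lra.
    + destruct (mean u ltac:(lra)) as [c [hc ->]].
      replace ((u * k1 u - k1 c * u) / u ^ 2) with ((k1 u - k1 c) * / u) by (field; lra).
      assert (iu : 0 < / u) by (apply Rinv_0_lt_compat; lra).
      rewrite Rabs_mult, (Rabs_pos_eq (/ u)) by lra.
      apply Rle_trans with (C * u * / u).
      * apply Rmult_le_compat_r; [lra|].
        apply Rle_trans with (1 := lip1 c u); apply Rmult_le_compat_l; [easy|].
        rewrite Rabs_pos_eq; lra.
      * right; field; lra. }
intros s t; destruct (Rle_dec s t) as [st|ts]; [now apply ordered|].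
rewrite (Rabs_minus_sym (quotient_at_0 k k1 t)), (Rabs_minus_sym t); apply ordered; lra.
Qed.

Definition mix (w a b t : R) : R := w * exp (a * t) + (1 - w) * exp (b * t).

Lemma mix_pos w a b t : 0 <= w <= 1 -> 0 < mix w a b t.
Proof.
intros hw; unfold mix; generalize (exp_pos (a * t)) (exp_pos (b * t)).
destruct (Rle_dec w (1 / 2)); nra.
Qed.

Definition log_mean (w a b t : R) : R :=
  quotient_at_0 (fun t => ln (mix w a b t))
    (fun t => (w * a * exp (a * t) + (1 - w) * b * exp (b * t)) / mix w a b t) t.

(** The second derivative of ln (w e^(a t) + (1 - w) e^(b t)) is the variance of
    a two-point distribution on {a, b}, at most (a - b)^2 whatever w is. *)
Lemma log_mean_lipschitz w a b s t : 0 <= w <= 1 ->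
  Rabs (log_mean w a b t - log_mean w a b s) <= (a - b) ^ 2 * Rabs (t - s).
Proof.
intros hw; apply quotient_at_0_lipschitz with
  (k2 := fun t => w * (1 - w) * (a - b) ^ 2 * (exp (a * t) * exp (b * t)) / mix w a b t ^ 2).
- unfold mix; rewrite !Rmult_0_r, exp_0, <- ln_1; f_equal; ring.
- intros u; generalize (mix_pos w a b u hw); unfold mix; intros p.
  auto_derive; [easy | field; lra].
- intros u; generalize (mix_pos w a b u hw); unfold mix; intros p.
  auto_derive; [lra | field; lra].
- intros u; generalize (mix_pos w a b u hw); intros p.
  generalize (exp_pos (a * u)) (exp_pos (b * u)) (pow2_ge_0 (a - b)); intros pa pb q.
  assert (p2 : 0 < mix w a b u ^ 2) by now apply pow_lt.
  set (x := exp (a * u)) in *; set (y := exp (b * u)) in *.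
  assert (xy : 0 <= w * (1 - w) * (x * y)) by (apply Rmult_le_pos; nra).
  assert (le : w * (1 - w) * (x * y) <= mix w a b u ^ 2).
{ unfold mix; fold x y; generalize (pow2_ge_0 (w * x)) (pow2_ge_0 ((1 - w) * y)); nra. }
  replace (w * (1 - w) * (a - b) ^ 2 * (x * y) / mix w a b u ^ 2)
    with ((a - b) ^ 2 * (w * (1 - w) * (x * y) / mix w a b u ^ 2)) by (field; lra).
  assert (r : 0 <= w * (1 - w) * (x * y) / mix w a b u ^ 2 <= 1).
  { split; [now apply Rdiv_le_0_compat|]; apply Rmult_le_reg_r with (mix w a b u ^ 2); [easy|].
    replace (w * (1 - w) * (x * y) / mix w a b u ^ 2 * mix w a b u ^ 2)
      with (w * (1 - w) * (x * y)) by (field; lra); lra. }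
  rewrite Rabs_pos_eq by (apply Rmult_le_pos; lra); nra.
Qed.

(** For t > 0 the power mean (w (e^a)^t + (1 - w) (e^b)^t)^(1/t), for t <= 0 the
    geometric mean, which is its limit at 0. *)
Definition gmean (w a b t : R) : R := exp (log_mean w a b t).

Lemma gmean_pos_time w a b t : 0 < t -> gmean w a b t = Rpower (mix w a b t) (1 / t).
Proof.
intros ht; unfold gmean, log_mean, quotient_at_0, Rpower.
destruct (Rle_dec t 0); [lra|]; f_equal; field; lra.
Qed.

Lemma gmean_nonpos_time w a b t : t <= 0 -> gmean w a b t = exp (w * a + (1 - w) * b).
Proof.
intros ht; unfold gmean, log_mean, quotient_at_0, mix.
destruct (Rle_dec t 0); [|lra]; f_equal; rewrite !Rmult_0_r, exp_0; field; lra.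
Qed.

(** Continuity in t, uniformly in the weight w: this is what makes the operator
    function continuous in norm. *)
Lemma gmean_continuous a b t e : 0 < e -> exists d, 0 < d /\
  forall s w, Rabs (s - t) < d -> 0 <= w <= 1 ->
  Rabs (gmean w a b s - gmean w a b t) <= e.
Proof.
intros he.
set (C := (a - b) ^ 2); assert (hC : 0 <= C) by apply pow2_ge_0.
set (B := Rabs a + Rabs b + C * Rabs t).
assert (bound : forall w, 0 <= w <= 1 -> log_mean w a b t <= B).
{ intros w hw; generalize (log_mean_lipschitz w a b 0 t hw); fold C.
  rewrite Rminus_0_r; intros l; apply Rabs_le_between in l.
  assert (z : log_mean w a b 0 = w * a + (1 - w) * b).
  { apply exp_inv; rewrite <- (gmean_nonpos_time w a b 0 ltac:(lra)); easy. }
  generalize (Rle_abs a) (Rle_abs b) (Rabs_pos a) (Rabs_pos b); intros; unfold B; nra. }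
assert (he' : 0 < e * exp (- B)) by (apply Rmult_lt_0_compat; [easy | apply exp_pos]).
assert (ce : continuity_pt exp 0) by apply derivable_continuous_pt, derivable_pt_exp.
destruct (proj1 (continuity_pt_locally exp 0) ce (mkposreal _ he')) as [d hd].
assert (hd0 : 0 < d / (C + 1)) by (apply Rdiv_lt_0_compat; [apply cond_pos | lra]).
exists (d / (C + 1)); split; [easy|]; intros s w hs hw.
set (r := log_mean w a b s - log_mean w a b t).
assert (hr : Rabs r < d).
{ apply Rle_lt_trans with (1 := log_mean_lipschitz w a b t s hw); fold C.
  apply Rle_lt_trans with (C * (d / (C + 1))); [apply Rmult_le_compat_l; lra|].
  replace (pos d) with ((C + 1) * (d / (C + 1))) at 2 by (field; lra); lra. }
assert (near : Rabs (exp r - 1) < e * exp (- B)).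
{ rewrite <- exp_0; apply hd; change (Rabs (r - 0) < d); now rewrite Rminus_0_r. }
replace (gmean w a b s - gmean w a b t) with (gmean w a b t * (exp r - 1)).
- rewrite Rabs_mult, Rabs_pos_eq by (left; apply exp_pos).
  replace e with (exp B * (e * exp (- B))).
  + apply Rmult_le_compat; [left; apply exp_pos | apply Rabs_pos | | lra].
    unfold gmean; generalize (bound w hw); intros [l| ->]; [left; now apply exp_increasing | lra].
  + rewrite exp_Ropp; field; apply Rgt_not_eq, exp_pos.
- unfold gmean, r; rewrite Rmult_minus_distr_l, <- exp_plus, Rmult_1_r; do 2 f_equal; ring.
Qed.

(** After division by e^(t y) the claim is
    1 <= t e^((1 - t) y) + (1 - t) e^(- t y), which follows from 1 + z <= e^z. *)
Lemma exp_convex t y : 0 <= t <= 1 -> exp (t * y) <= t * exp y + (1 - t).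
Proof.
intros ht.
assert (h : 1 <= t * exp ((1 - t) * y) + (1 - t) * exp (- (t * y))).
{ generalize (exp_ineq1_le ((1 - t) * y)) (exp_ineq1_le (- (t * y))); intros u v; nra. }
apply Rmult_le_compat_l with (r := exp (t * y)) in h; [|left; apply exp_pos].
rewrite Rmult_1_r in h; apply Rle_trans with (1 := h); right.
transitivity (t * (exp (t * y) * exp ((1 - t) * y))
  + (1 - t) * (exp (t * y) * exp (- (t * y)))); [ring|].
rewrite <- !exp_plus; replace (t * y + (1 - t) * y) with y by ring.
rewrite Rplus_opp_r, exp_0; ring.
Qed.

Lemma Rpower_ge_exp X t c : 0 < t -> 0 < X -> exp (t * c) <= X -> exp c <= Rpower X (1 / t).
Proof.
intros ht hX h; unfold Rpower.
assert (le : c <= 1 / t * ln X).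
{ apply Rmult_le_reg_l with t; [easy|].
  replace (t * (1 / t * ln X)) with (ln X) by (field; lra).
  rewrite <- (ln_exp (t * c)); destruct h as [h| ->]; [left; apply ln_increasing|]; try lra.
  apply exp_pos. }
destruct le as [le| ->]; [left; now apply exp_increasing | lra].
Qed.

Lemma Rpower_le_exp X t c : 0 < t -> 0 < X -> X <= exp (t * c) -> Rpower X (1 / t) <= exp c.
Proof.
intros ht hX h; unfold Rpower.
assert (le : 1 / t * ln X <= c).
{ apply Rmult_le_reg_l with t; [easy|].
  replace (t * (1 / t * ln X)) with (ln X) by (field; lra).
  rewrite <- (ln_exp (t * c)); destruct h as [h| ->]; [left; now apply ln_increasing | lra]. }
destruct le as [le| ->]; [left; now apply exp_increasing | lra].
Qed.

Lemma ln_le_pred x : 0 < x -> ln x <= x - 1.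
Proof.
intros hx; generalize (exp_ineq1_le (ln x)); rewrite exp_ln by easy; lra.
Qed.

(** With s = w m + (1 - w) M the claim reads
    1 <= w (s / m)^t + (1 - w) (s / M)^t.  From 1 + z <= e^z the right side is at
    least 1 + t (ln s - w ln m - (1 - w) ln M), and ln is concave. *)
Lemma gmean_ge w m M t : 0 < m -> 0 < M -> 0 <= w <= 1 -> 0 < t ->
  / (w * m + (1 - w) * M) <= gmean w (- ln m) (- ln M) t.
Proof.
intros hm hM hw ht; rewrite gmean_pos_time by easy.
set (s := w * m + (1 - w) * M).
assert (hs : 0 < s) by (unfold s; destruct (Rle_dec w (1 / 2)); nra).
rewrite <- (exp_ln s hs), <- exp_Ropp.
apply Rpower_ge_exp; [easy | now apply mix_pos|].
assert (conc : w * ln m + (1 - w) * ln M <= ln s).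
{ generalize (ln_le_pred (m / s) ltac:(now apply Rdiv_lt_0_compat))
    (ln_le_pred (M / s) ltac:(now apply Rdiv_lt_0_compat)).
  rewrite !ln_div by easy; intros u v.
  assert (e : w * (m / s) + (1 - w) * (M / s) = 1).
  { transitivity ((w * m + (1 - w) * M) / s); [field; lra|]; fold s; field; lra. }
  nra. }
assert (h : 1 <= w * exp (t * (ln s - ln m)) + (1 - w) * exp (t * (ln s - ln M))).
{ generalize (exp_ineq1_le (t * (ln s - ln m))) (exp_ineq1_le (t * (ln s - ln M))).
  intros u v.
  assert (0 <= t * (ln s - (w * ln m + (1 - w) * ln M))) by (apply Rmult_le_pos; lra).
  nra. }
apply Rmult_le_compat_l with (r := exp (t * - ln s)) in h; [|left; apply exp_pos].
rewrite Rmult_1_r in h; apply Rle_trans with (1 := h); right; unfold mix.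
rewrite Rmult_plus_distr_l.
replace (- ln m * t) with (t * - ln s + t * (ln s - ln m)) by ring.
replace (- ln M * t) with (t * - ln s + t * (ln s - ln M)) by ring.
rewrite !exp_plus; ring.
Qed.

(** Divide by the arithmetic mean s = w / m + (1 - w) / M and average the
    inequality u^t <= t u + (1 - t) over u = (1/m) / s and u = (1/M) / s, whose mean
    is 1. *)
Lemma gmean_le w m M t : 0 < m -> 0 < M -> 0 <= w <= 1 -> 0 < t <= 1 ->
  gmean w (- ln m) (- ln M) t <= w / m + (1 - w) / M.
Proof.
intros hm hM hw ht; rewrite gmean_pos_time by easy.
generalize (Rinv_0_lt_compat m hm) (Rinv_0_lt_compat M hM); intros im iM.
set (s := w / m + (1 - w) / M).
assert (hs : 0 < s) by (unfold s, Rdiv; destruct (Rle_dec w (1 / 2)); nra).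
rewrite <- (exp_ln s hs) at 1.
apply Rpower_le_exp; [easy | now apply mix_pos|].
generalize (exp_convex t (- ln m - ln s) ltac:(lra)) (exp_convex t (- ln M - ln s) ltac:(lra)).
assert (em : forall x, 0 < x -> exp (- ln x - ln s) = / x / s).
{ intros x hx; unfold Rminus; rewrite exp_plus, !exp_Ropp, !exp_ln by easy; easy. }
rewrite !em by easy; intros u v.
assert (e : w * (/ m / s) + (1 - w) * (/ M / s) = 1).
{ transitivity ((w / m + (1 - w) / M) / s); [field; lra|]; fold s; field; lra. }
assert (h : w * exp (t * (- ln m - ln s)) + (1 - w) * exp (t * (- ln M - ln s)) <= 1).
{ apply Rle_trans with (w * (t * (/ m / s) + (1 - t)) + (1 - w) * (t * (/ M / s) + (1 - t))).
  - apply Rplus_le_compat; apply Rmult_le_compat_l; lra.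
  - right; transitivity (t * (w * (/ m / s) + (1 - w) * (/ M / s)) + (1 - t)); [ring|].
    rewrite e; ring. }
apply Rmult_le_compat_l with (r := exp (t * ln s)) in h; [|left; apply exp_pos].
rewrite Rmult_1_r in h; apply Rle_trans with (2 := h); right; unfold mix.
rewrite Rmult_plus_distr_l.
replace (- ln m * t) with (t * ln s + t * (- ln m - ln s)) by ring.
replace (- ln M * t) with (t * ln s + t * (- ln M - ln s)) by ring.
rewrite !exp_plus; ring.
Qed.

(** * Integrals of operator functions and the inequalities *)

(** T |-> <T x, y> is linear and bounded, so it commutes with Riemann sums and
    with their limit. *)
Lemma is_RInt_form {H : Hilbert} (F : R -> Op H) a b J (x y : H) :
  is_RInt F a b J -> is_RInt (fun t => ip (F t x) y) a b (ip (J x) y).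
Proof.
intros hF.
assert (sum : forall ptd, Riemann_sum (fun t => ip (F t x) y) ptd
                        = ip (Riemann_sum F ptd x) y).
{ apply SF_cons_ind.
  - intros x0; change (0 = ip (zero : H) y); symmetry; apply ip_zero_l.
  - intros h ptd IH; rewrite !Riemann_sum_cons, IH; expand; reflexivity. }
unfold is_RInt in *; apply filterlim_locally; intros e.
set (c := norm x * norm y + 1).
assert (hc : 0 < c).
{ unfold c; generalize (Rmult_le_pos _ _ (norm_ge_0 x) (norm_ge_0 y)); lra. }
assert (he : 0 < e / c) by (apply Rdiv_lt_0_compat; [apply cond_pos | easy]).
generalize (proj1 (filterlim_locally _ _) hF (mkposreal _ he)).
apply filter_imp; intros ptd h.
change (op_norm (minus (scal (sign (b - a)) (Riemann_sum F ptd)) J) < e / c) in h.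
change (Rabs (sign (b - a) * Riemann_sum (fun t => ip (F t x) y) ptd - ip (J x) y) < e).
rewrite sum.
apply Rle_lt_trans with (e / c * (norm x * norm y)).
- apply Rle_trans with (2 := op_form_close _ _ _ x y (Rlt_le _ _ h)); right; f_equal.
  expand; reflexivity.
- apply Rlt_le_trans with (e / c * c); [|right; field; lra].
  apply Rmult_lt_compat_l; [easy | unfold c; lra].
Qed.

Lemma is_RInt_op_le {H : Hilbert} (F : R -> Op H) J : is_RInt F 0 1 J ->
  (forall t, 0 < t < 1 -> self_adjoint (F t)) ->
  (forall Y, self_adjoint Y -> (forall t, 0 < t < 1 -> op_le Y (F t)) -> op_le Y J) /\
  (forall Y, self_adjoint Y -> (forall t, 0 < t < 1 -> op_le (F t) Y) -> op_le J Y).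
Proof.
intros hF saF.
assert (saJ : forall x y, ip (J x) y = ip x (J y)).
{ intros x y; rewrite (ip_sym x).
  rewrite <- (is_RInt_unique _ _ _ _ (is_RInt_form F 0 1 J x y hF)).
  rewrite <- (is_RInt_unique _ _ _ _ (is_RInt_form F 0 1 J y x hF)).
  apply RInt_ext; rewrite Rmin_left, Rmax_right by lra; intros t ht.
  rewrite (ip_sym (F t y)); now apply self_adjoint_ip, saF. }
assert (const : forall r : R, is_RInt (fun _ => r) 0 1 r).
{ intros r; evar_last; [apply (is_RInt_const (V := R_NormedModule))|].
  change ((1 - 0) * r = r); ring. }
split; intros Y saY le; apply positive_ip.
- intros x y; expand; now rewrite saJ, (proj1 (self_adjoint_ip Y) saY).
- intros x; expand.
  cut (ip (Y x) x <= ip (J x) x); [lra|].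
  apply (is_RInt_le (fun _ => ip (Y x) x) (fun t => ip (F t x) x) 0 1); try lra.
  + apply const.
  + now apply is_RInt_form.
  + intros t ht; now apply op_le_ip, le.
- intros x y; expand; now rewrite saJ, (proj1 (self_adjoint_ip Y) saY).
- intros x; expand.
  cut (ip (J x) x <= ip (Y x) x); [lra|].
  apply (is_RInt_le (fun t => ip (F t x) x) (fun _ => ip (Y x) x) 0 1); try lra.
  + now apply is_RInt_form.
  + apply const.
  + intros t ht; now apply op_le_ip, le.
Qed.

Lemma sa_between_poly {H : Hilbert} (T U : Op H) lo hi lo' hi' g : lo <= hi ->
  sa_between T lo hi -> poly_pair T g U ->
  (forall x, lo <= x <= hi -> lo' <= g x <= hi') -> sa_between U lo' hi'.
Proof.
intros lohi hT hg b; split; [|split].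
- apply (poly_pair_self_adjoint T g); [apply hT | easy].
- apply (calculus_le T lo hi (fun _ => lo') g); try easy.
  + apply calculus_poly, poly_pair_const.
  + now apply calculus_poly.
  + intros x hx; now apply b.
- apply (calculus_le T lo hi g (fun _ => hi')); try easy.
  + now apply calculus_poly.
  + apply calculus_poly, poly_pair_const.
  + intros x hx; now apply b.
Qed.

Lemma map_minus {H K : Hilbert} (Phi : Op H -> Op K) S T :
  linear_map Phi -> Phi (minus S T) = minus (Phi S) (Phi T).
Proof.
intros [add hom]; replace (minus S T) with (plus S (op_scal (RtoC (-1)) T)).
- rewrite add, hom; op_vec.
- op_vec.
Qed.

Lemma map_op_le {H K : Hilbert} (Phi : Op H -> Op K) S T :
  linear_map Phi -> positive_map Phi -> op_le S T -> op_le (Phi S) (Phi T).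
Proof.
intros lin pos le; unfold op_le; rewrite <- map_minus by easy; now apply pos.
Qed.

Lemma op_le_trans {H : Hilbert} (S T U : Op H) : op_le S T -> op_le T U -> op_le S U.
Proof.
intros h1 h2; generalize (op_le_ip _ _ h1) (op_le_ip _ _ h2); intros a b.
destruct h1 as [s1 _], h2 as [s2 _]; apply positive_ip.
- intros x y; generalize (proj1 (self_adjoint_ip _) s1 x y) (proj1 (self_adjoint_ip _) s2 x y).
  expand; lra.
- intros x; generalize (a x) (b x); expand; lra.
Qed.

Lemma calculus_op_inv {H : Hilbert} (T : Op H) lo hi : 0 < lo < hi -> sa_between T lo hi ->
  interval_calculus T lo hi (fun x => / x) (op_inv T).
Proof.
intros pos hT; destruct (calculus_exists T lo hi (fun x => / (x - 0)) ltac:(lra) hT) as [Y hY].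
{ intros x hx; apply continuity_pt_inv; [|lra].
  apply continuity_pt_minus; [apply continuity_pt_id | now apply continuity_pt_const]. }
replace (op_inv T) with Y.
- intros e he; destruct (hY e he) as [p [P [hp [ap nP]]]]; exists p, P; repeat split; try easy.
  intros x hx; generalize (ap x hx); now rewrite Rminus_0_r.
- symmetry; apply op_inv_eq.
  replace T with (minus T (scal 0 op_one)) by op_vec.
  apply (calculus_inverse T lo hi 0); try easy; intros x hx; lra.
Qed.

Definition mean_base {H : Hilbert} (m M : R) (A : Op H) (t : R) : Op H :=
  plus (scal (Rpower m (- t)) (scal (/ (M - m)) (minus (scal M op_one) A)))
       (scal (Rpower M (- t)) (scal (/ (M - m)) (minus A (scal m op_one)))).

Definition weight (m M s : R) : R := / (M - m) * (M - s).

Lemma weight_bounds m M s : m < M -> m <= s <= M ->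
  0 <= weight m M s <= 1 /\ weight m M s * m + (1 - weight m M s) * M = s.
Proof.
intros mM hs.
assert (i : 0 < / (M - m)) by (apply Rinv_0_lt_compat; lra).
assert (e : weight m M s * (M - m) = M - s) by (unfold weight; field; lra).
assert (e' : 1 - weight m M s = / (M - m) * (s - m)) by (unfold weight; field; lra).
repeat split; [| | nra].
- apply Rmult_le_pos; lra.
- assert (0 <= / (M - m) * (s - m)) by (apply Rmult_le_pos; lra); lra.
Qed.

Lemma mean_base_poly {H : Hilbert} m M (A : Op H) t : m < M ->
  poly_pair A (fun s => mix (weight m M s) (- ln m) (- ln M) t) (mean_base m M A t).
Proof.
intros mM.
apply poly_pair_ext with (fun s => Rpower m (- t) * (/ (M - m) * (M - s))
    + Rpower M (- t) * (/ (M - m) * (s - m))) (mean_base m M A t); [|intros s|easy].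
- apply poly_pair_plus; apply poly_pair_scal, poly_pair_scal, poly_pair_minus;
    first [apply poly_pair_const | apply poly_pair_id].
- unfold mix, weight, Rpower.
  replace (- ln m * t) with (- t * ln m) by ring.
  replace (- ln M * t) with (- t * ln M) by ring; field; lra.
Qed.

(** The power is defined by the calculus of the base operator, which lies between
    M^(-t) and m^(-t); composing with the affine function that expresses the base
    in A turns it into a function of A. *)
Lemma op_power_mean_base {H : Hilbert} m M (A : Op H) t : 0 < m -> m < M ->
  sa_between A m M -> 0 < t ->
  interval_calculus A m M (fun s => gmean (weight m M s) (- ln m) (- ln M) t)
    (op_power (mean_base m M A t) (1 / t)).
Proof.
intros hm mM hA ht.
set (lo := exp (- ln M * t)); set (hi := exp (- ln m * t)).
assert (lohi : lo < hi).
{ apply exp_increasing; generalize (ln_increasing m M hm mM); nra. }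
assert (lo0 : 0 < lo) by apply exp_pos.
generalize (mean_base_poly m M A t mM); intros hU.
assert (b : forall s, m <= s <= M ->
          lo <= mix (weight m M s) (- ln m) (- ln M) t <= hi).
{ intros s hs; destruct (weight_bounds m M s mM hs) as [hw _].
  unfold mix; fold lo hi; nra. }
assert (hB : sa_between (mean_base m M A t) lo hi).
{ apply (sa_between_poly A _ m M lo hi _ ltac:(lra) hA hU b). }
destruct (calculus_exists (mean_base m M A t) lo hi (fun x => Rpower x (1 / t)) lohi hB) as [Y hY].
{ intros x hx; apply derivable_continuous_pt.
  exists (1 / t * Rpower x (1 / t - 1)); apply derivable_pt_lim_power; lra. }
unfold op_power; rewrite (cfc_eq _ lo hi _ Y lohi hB hY).
intros e he; destruct (calculus_comp A _ m M lo hi _ _ Y hU b hY e he) as [p [P [hp [ap nP]]]].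
exists p, P; repeat split; try easy.
intros s hs; rewrite gmean_pos_time by easy; now apply ap.
Qed.

Lemma mean_calculus_exists {H : Hilbert} m M (A : Op H) t : 0 < m -> m < M -> sa_between A m M ->
  exists Y, interval_calculus A m M (fun s => gmean (weight m M s) (- ln m) (- ln M) t) Y.
Proof.
intros hm mM hA; destruct (Rle_dec t 0) as [t0|t0].
- destruct (calculus_exists A m M
    (fun s => exp (weight m M s * - ln m + (1 - weight m M s) * - ln M)) mM hA) as [Y hY].
  { intros s _; apply continuity_pt_filterlim, (ex_derive_continuous
      (fun s => exp (weight m M s * - ln m + (1 - weight m M s) * - ln M)) s).
    unfold weight; auto_derive; easy. }
  exists Y; intros e he; destruct (hY e he) as [p [P [hp [ap nP]]]].
  exists p, P; repeat split; try easy.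
  intros s hs; rewrite gmean_nonpos_time by easy; now apply ap.
- eexists; apply op_power_mean_base; try easy; lra.
Qed.

(** The integrand agrees on (0, 1) with a function F of t that is defined for all
    t and continuous in norm. *)
Lemma mean_integral {H : Hilbert} m M (A : Op H) : 0 < m -> m < M -> sa_between A m M ->
  is_RInt (fun t => op_power (mean_base m M A t) (1 / t)) 0 1
    (RInt (fun t => op_power (mean_base m M A t) (1 / t)) 0 1).
Proof.
intros hm mM hA; apply (RInt_correct (V := Op_CompleteNormedModule H)).
set (F := fun t => proj1_sig (constructive_indefinite_description _
                     (mean_calculus_exists m M A t hm mM hA))).
assert (hF : forall t,
  interval_calculus A m M (fun s => gmean (weight m M s) (- ln m) (- ln M) t) (F t)).
{ intros t; exact (proj2_sig (constructive_indefinite_description _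
                     (mean_calculus_exists m M A t hm mM hA))). }
apply ex_RInt_ext with F.
{ rewrite Rmin_left, Rmax_right by lra; intros t ht.
  apply (calculus_unique A m M _ _ _ _ hA (hF t)
    (op_power_mean_base m M A t hm mM hA (proj1 ht))); easy. }
apply (ex_RInt_continuous (V := Op_CompleteNormedModule H)); intros t _.
apply filterlim_locally; intros e.
destruct (gmean_continuous (- ln m) (- ln M) t (e / 2)) as [d [hd cont]].
{ generalize (cond_pos e); lra. }
exists (mkposreal d hd); intros s hs.
change (op_norm (minus (F s) (F t)) < e).
apply Rle_lt_trans with (e / 2); [|generalize (cond_pos e); lra].
apply (calculus_dist A m M _ _ _ _ _ hA (hF s) (hF t)); [generalize (cond_pos e); lra|].
intros x hx; apply cont; [exact hs | now apply weight_bounds].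
Qed.

Lemma mean_integral_bounds {H : Hilbert} m M (A : Op H) :
  0 < m -> m < M -> sa_between A m M ->
  let J := RInt (fun t => op_power (mean_base m M A t) (1 / t)) 0 1 in
  op_le (op_inv A) J /\
  op_le J (scal (/ (M * m)) (minus (scal (M + m) op_one) A)).
Proof.
intros hm mM hA J.
generalize (calculus_op_inv A m M (conj hm mM) hA); intros hinv.
assert (hmean : forall t, 0 < t < 1 -> interval_calculus A m M
          (fun s => gmean (weight m M s) (- ln m) (- ln M) t)
          (op_power (mean_base m M A t) (1 / t))).
{ intros t ht; now apply op_power_mean_base. }
set (chord := fun s => / (M * m) * ((M + m) - s)).
assert (hchord : interval_calculus A m M chord (scal (/ (M * m)) (minus (scal (M + m) op_one) A))).
{ apply calculus_poly, poly_pair_scal, poly_pair_minus; [apply poly_pair_const | apply poly_pair_id]. }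
destruct (is_RInt_op_le _ J (mean_integral m M A hm mM hA)) as [low up].
{ intros t ht; exact (calculus_self_adjoint A m M _ _ hA (hmean t ht)). }
split.
- apply low; [exact (calculus_self_adjoint A m M _ _ hA hinv)|].
  intros t ht; apply (calculus_le A m M _ _ _ _ (Rlt_le _ _ mM) hA hinv (hmean t ht)).
  intros s hs; destruct (weight_bounds m M s mM hs) as [hw e].
  rewrite <- e at 1; apply gmean_ge; lra.
- apply up; [exact (calculus_self_adjoint A m M _ _ hA hchord)|].
  intros t ht; apply (calculus_le A m M _ _ _ _ (Rlt_le _ _ mM) hA (hmean t ht) hchord).
  intros s hs; destruct (weight_bounds m M s mM hs) as [hw e].
  apply Rle_trans with (weight m M s / m + (1 - weight m M s) / M).
  + apply gmean_le; lra.
  + right; unfold chord; rewrite <- e at 3; field; lra.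
Qed.

(** The difference of the two functions of s is
    (M + m - 2 s)^2 / (4 M m s). *)
Lemma chord_le_inv {K : Hilbert} m M (B : Op K) : 0 < m -> m < M -> sa_between B m M ->
  op_le (scal (/ (M * m)) (minus (scal (M + m) op_one) B))
        (scal ((M + m) ^ 2 / (4 * M * m)) (op_inv B)).
Proof.
intros hm mM hB.
apply (calculus_le B m M (fun s => / (M * m) * ((M + m) - s))
  (fun s => (M + m) ^ 2 / (4 * M * m) * / s)); try easy; [lra | | |].
- apply calculus_poly, poly_pair_scal, poly_pair_minus; [apply poly_pair_const | apply poly_pair_id].
- apply calculus_scal; now apply calculus_op_inv.
- intros s hs.
  replace ((M + m) ^ 2 / (4 * M * m) * / s)
    with (/ (M * m) * ((M + m) - s) + (M + m - 2 * s) ^ 2 * / (4 * M * m * s)) by (field; lra).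
  assert (0 < / (4 * M * m * s)) by (apply Rinv_0_lt_compat; repeat apply Rmult_lt_0_compat; lra).
  generalize (pow2_ge_0 (M + m - 2 * s)); nra.
Qed.

Theorem mainTheorem3 (H K : Hilbert) (m M : R) (A : Op H) (Phi : Op H -> Op K)
  (hm : 0 < m) (hmM : m < M)
  (hA : self_adjoint A) (hmA : op_le (scal m op_one) A) (hAM : op_le A (scal M op_one))
  (hlin : linear_map Phi) (hpos : positive_map Phi) (hunit : unital_map Phi) :
  let J := RInt (fun t : R => op_power
      (plus (scal (Rpower m (- t)) (scal (/ (M - m)) (minus (scal M op_one) A)))
            (scal (Rpower M (- t)) (scal (/ (M - m)) (minus A (scal m op_one)))))
      (1 / t)) 0 1 in
  op_le (Phi (op_inv A)) (Phi J) /\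
  op_le (Phi J) (scal ((M + m) ^ 2 / (4 * M * m)) (op_inv (Phi A))).
Proof.
intros J.
assert (bA : sa_between A m M) by easy.
destruct (mean_integral_bounds m M A hm hmM bA) as [low up].
change (op_le (op_inv A) J) in low.
change (op_le J (scal (/ (M * m)) (minus (scal (M + m) op_one) A))) in up.
assert (map_scal : forall (r : R) (T : Op H), Phi (scal r T) = scal r (Phi T)).
{ intros r T; exact (proj2 hlin (RtoC r) T). }
assert (bB : sa_between (Phi A) m M).
{ generalize (map_op_le Phi _ _ hlin hpos hmA) (map_op_le Phi _ _ hlin hpos hAM).
  rewrite !map_scal, hunit; intros l u; repeat split; try apply l; try apply u.
  destruct l as [l _]; apply self_adjoint_ip; intros x y.
  generalize (proj1 (self_adjoint_ip _) l x y); expand; lra. }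
split; [now apply map_op_le|].
apply op_le_trans with (2 := chord_le_inv m M (Phi A) hm hmM bB).
assert (chord : Phi (scal (/ (M * m)) (minus (scal (M + m) op_one) A))
              = scal (/ (M * m)) (minus (scal (M + m) op_one) (Phi A))).
{ rewrite map_scal; f_equal.
  transitivity (minus (Phi (scal (M + m) op_one)) (Phi A)); [exact (map_minus Phi _ _ hlin)|].
  now rewrite map_scal, hunit. }
rewrite <- chord; now apply map_op_le.
Qed.
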